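(* Let $\mathsf{K} \subset \mathbb{R}^n$ be a nonempty convex body with rigid motion volume random variable $\bar{I}_{\mathsf{K}}$ and central rigid motion volume $\bar{\delta}(\mathsf{K}) = \mathbb{E}\,\bar{I}_{\mathsf{K}}$. Then for all $t \geq 0$, $$ \mathbb{P}\left\{ \left| \bar{I}_{\mathsf{K}} - \bar{\delta}(\mathsf{K}) \right| \geq t \right\} \leq 2 \exp\left( \frac{-t^2/4}{\bar{\sigma}^2(\mathsf{K}) + t/3} \right), \quad\text{where}\quad \bar{\sigma}^2(\mathsf{K}) := \min\big\{ \bar{\delta}(\mathsf{K}),\ (n+1) - \bar{\delta}(\mathsf{K}) \big\}. $$
   Context: Let $n \geq 1$ be an integer. A convex body in $\mathbb{R}^n$ is a compact convex subset of $\mathbb{R}^n$ (it may have empty interior). $\mathsf{B}^n$ is the closed Euclidean unit ball, $\kappa_j = \pi^{j/2}/\Gamma(1+j/2)$ and $\omega_j = j\kappa_j = 2\pi^{j/2}/\Gamma(j/2)$ are the volume and surface area of the $j$-dimensional unit ball. The intrinsic volumes $V_0(\mathsf{K}),\dots,V_n(\mathsf{K})$ of a nonempty convex body $\mathsf{K}\subset\mathbb{R}^n$ are the numbers determined by Steiner's formula $\mathrm{Vol}_n(\mathsf{K}+\lambda \mathsf{B}^n) = \sum_{i=0}^n \lambda^{n-i}\kappa_{n-i}\, V_i(\mathsf{K})$ for all $\lambda\geq 0$, where $+$ is Minkowski sum. Rigid motion volumes and total rigid motion volume: $\bar{V}_i(\mathsf{K}) := \frac{\omega_{n+1}}{\omega_{i+1}}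 V_{i}(\mathsf{K})$ for $i=0,\dots,n$, and $\bar{W}(\mathsf{K}) := \sum_{i=0}^n \bar{V}_i(\mathsf{K})$. The rigid motion volume random variable $\bar{I}_{\mathsf{K}}$ takes values in $\{0,1,\dots,n\}$ with $\mathbb{P}\{\bar{I}_{\mathsf{K}} = n-i\} = \bar{V}_i(\mathsf{K})/\bar{W}(\mathsf{K})$. Its expectation $\bar{\delta}(\mathsf{K}) := \mathbb{E}\,\bar{I}_{\mathsf{K}}$ is the central rigid motion volume. *)

(* Defs.v *)
From HB Require Import structures.
From mathcomp Require Import all_boot all_order all_algebra.
From mathcomp Require Import all_classical all_reals all_analysis.
Import Order.TTheory GRing.Theory Num.Theory.
Import numFieldNormedType.Exports.
Set Implicit Arguments.
Unset Strict Implicit.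
Unset Printing Implicit Defensive.
Local Open Scope classical_set_scope.
Local Open Scope ring_scope.

Section lebesgue_tuple.
Context {R : realType}.

(* n-tuples of reals carry the product of the Borel sigma-algebras. *)
Local Notation tupR n := (n.-tuple (measurableTypeR R)).

Definition tuple_cons n (p : measurableTypeR R * tupR n) : tupR n.+1 :=
  [tuple of p.1 :: p.2].

Lemma measurable_tuple_cons n : measurable_fun setT (@tuple_cons n).
Proof. exact: measurable_cons. Qed.

Section step.
Variables (n : nat) (mu : {sigma_finite_measure set (tupR n) -> \bar R}).

Definition lebesgue_cons : set (tupR n.+1) -> \bar R :=
  pushforward (lebesgue_measure \x mu)%E (@tuple_cons n).

Let lebesgue_cons0 : lebesgue_cons set0 = 0%E.
Proof. by rewrite /lebesgue_cons /pushforward preimage_set0 measure0. Qed.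

Let lebesgue_cons_ge0 A : (0 <= lebesgue_cons A)%E.
Proof. exact: (measure_ge0 (lebesgue_measure \x mu)%E). Qed.

Let lebesgue_cons_sigma_additive : semi_sigma_additive lebesgue_cons.
Proof.
have mf := @measurable_tuple_cons n.
move=> F mF tF mUF; rewrite /lebesgue_cons /pushforward preimage_bigcup.
apply: measure_semi_sigma_additive.
- by move=> k; rewrite -[X in measurable X]setTI; exact: mf.
- apply/trivIsetP => /= i j _ _ ij; rewrite -preimage_setI.
  by move/trivIsetP : tF => /(_ _ _ _ _ ij) ->//; rewrite preimage_set0.
- by rewrite -preimage_bigcup -[X in measurable X]setTI; exact: mf.
Qed.

HB.instance Definition _ := isMeasure.Build _ _ _ lebesgue_cons
  lebesgue_cons0 lebesgue_cons_ge0 lebesgue_cons_sigma_additive.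

Let uncons (t : tupR n.+1) : measurableTypeR R * tupR n :=
  (tnth t ord0, [tuple of behead t]).

Let measurable_uncons : measurable_fun setT uncons.
Proof.
apply: measurable_fun_pair; first exact: measurable_tnth.
exact: measurable_behead.
Qed.

Let tuple_consK : cancel (@tuple_cons n) uncons.
Proof.
case=> x t; rewrite /uncons /tuple_cons/=; congr pair.
exact/val_inj.
Qed.

Let lebesgue_cons_sigma_finite : sigma_finite setT lebesgue_cons.
Proof.
have [F [FT ndF Foo]] := (sigma_finiteP _ _).1
  (sigma_finiteT (@lebesgue_measure R)).
have [G [GT ndG Goo]] := (sigma_finiteP _ _).1 (sigma_finiteT mu).
exists (fun k => uncons @^-1` (F k `*` G k)).
  rewrite -preimage_bigcup -[LHS](@preimage_setT _ _ uncons); congr (_ @^-1` _).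
  apply/seteqP; split=> // -[x t] _.
  have [i _ Fx] : (\bigcup_k F k) x by rewrite -FT.
  have [j _ Gt] : (\bigcup_k G k) t by rewrite -GT.
  exists (maxn i j) => //; split => /=.
    by move: Fx; exact/subsetPset/ndF/leq_maxl.
  by move: Gt; exact/subsetPset/ndG/leq_maxr.
move=> k; have [mF Fk] := Foo k; have [mG Gk] := Goo k; split.
  by rewrite -[X in measurable X]setTI; apply: measurable_uncons => //;
    exact: measurableX.
rewrite /lebesgue_cons /pushforward -comp_preimage.
rewrite (_ : uncons \o _ = id); last by apply/funext => p; exact: tuple_consK.
rewrite preimage_id product_measure1E//.
by rewrite lte_mul_pinfty// ge0_fin_numE.
Qed.

HB.instance Definition _ := Measure_isSigmaFinite.Build _ _ _ lebesgue_cons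
  lebesgue_cons_sigma_finite.

End step.

(* Lebesgue measure on R^n: the n-fold product of `lebesgue_measure`; R^0
   carries the unit point mass. *)
Fixpoint lebesgue_tuple n : {sigma_finite_measure set (tupR n) -> \bar R} :=
  match n return {sigma_finite_measure set (tupR n) -> \bar R} with
  | 0 => dirac [tuple]
  | m.+1 => lebesgue_cons (lebesgue_tuple m)
  end.

Lemma lebesgue_tuple_box n (A : 'I_n -> set (measurableTypeR R)) :
  (forall i, measurable (A i)) ->
  lebesgue_tuple n [set t | forall i, A i (tnth t i)] =
  (\prod_(i < n) lebesgue_measure (A i))%E.
Proof.
elim: n A => [|n IH] A mA.
  by rewrite big_ord0 /= diracE (_ : _ \in _ = true)//; apply/mem_set => -[].
rewrite big_ord_recl -IH//= /lebesgue_cons /pushforward.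
rewrite -product_measure1E//; last first.
  rewrite (_ : mkset _ = \bigcap_(i in [set: 'I_n])
      [set t : tupR n | A (lift ord0 i) (tnth t i)]).
    apply: fin_bigcap_measurable => // i _.
    rewrite -[X in measurable X]setTI.
    exact: (measurable_tnth i measurableT (mA (lift ord0 i))).
  by apply/seteqP; split=> t /= At i => [_|]; exact: At.
congr (_ _); apply/seteqP; split=> -[x t] /=.
  by move=> At; split=> [|i]; [exact: (At ord0)|have := At (lift ord0 i); rewrite tnthS].
by move=> [Ax At] i; case: (unliftP ord0 i) => [j ->|->//]; rewrite tnthS.
Qed.

End lebesgue_tuple.

Section euclidean.
Context {R : realType} {n : nat}.
Implicit Types K : set 'rV[R]_n.

Definition volume (A : set 'rV[R]_n) : \bar R :=
  lebesgue_tuple n [set t | A (\row_i tnth t i)].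

(* Empty interior is allowed. *)
Definition convex_body K : Prop := compact K /\ convex_set K.

(* The norm `|x| of the library on 'rV[R]_n is the sup norm, hence this
   explicit Euclidean ball. *)
Definition unit_ball : set 'rV[R]_n :=
  [set x | Num.sqrt (\sum_i x ord0 i ^+ 2) <= 1].

(* The Minkowski sum K + lambda B. *)
Definition parallel_body K (lambda : R) : set 'rV[R]_n :=
  [set x + lambda *: y | x in K & y in unit_ball].

End euclidean.

(* Euler's integral, for a > 0. *)
Definition Gamma {R : realType} (a : R) : R :=
  \int[lebesgue_measure]_(x in `]0%R, +oo[) (x `^ (a - 1) * expR (- x)).

Section rigid_motion_volumes.
Context {R : realType}.

Definition kappa (j : nat) : R := pi `^ (j%:R / 2) / Gamma (1 + j%:R / 2).

Definition omega (j : nat) : R := j%:R * kappa j.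

Context {n : nat}.
Implicit Types K : set 'rV[R]_n.

Definition steiner K (V : {ffun 'I_n.+1 -> R}) : Prop :=
  forall lambda : R, 0 <= lambda ->
    volume (parallel_body K lambda) =
    (\sum_(i < n.+1) lambda ^+ (n - i) * kappa (n - i) * V i)%:E.

(* Steiner's formula determines V, and it holds for every nonempty convex body;
   the default value 0 only serves other sets. *)
Definition intrinsic_volume K : {ffun 'I_n.+1 -> R} :=
  xget [ffun=> 0] (steiner K).

Definition rigid_motion_volume K (i : 'I_n.+1) : R :=
  omega n.+1 / omega i.+1 * intrinsic_volume K i.

Definition total_rigid_motion_volume K : R :=
  \sum_(i < n.+1) rigid_motion_volume K i.

Section random_variable.
Context {d : measure_display} {T : measurableType d} {P : probability T R}.

(* I is the rigid motion volume random variable of K; for i <= n, the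
   subtraction n - i in nat is exact. *)
Definition rigid_motion_volume_rv K (I : {RV P >-> R}) : Prop :=
  (forall w, exists k : 'I_n.+1, I w = k%:R) /\
  (forall i : 'I_n.+1, P [set w | I w = (n - i)%:R] =
    (rigid_motion_volume K i / total_rigid_motion_volume K)%:E).

(* The central rigid motion volume of K, when I has the law above. *)
Definition central_volume (I : {RV P >-> R}) : R := fine 'E_P[I].

End random_variable.

End rigid_motion_volumes.

(* Main.v *)
(* Put Q(a,b) = Vol(aK + bB) = \sum_i kappa_{n-i} V_i a^i b^{n-i}. By the
   Prekopa-Leindler inequality Q is log-concave. Since sqrt(s y) and sqrt(t z)
   are concave in (s,y) and (t,z), the same inequality shows that
     W(s,t) = \int_{y,z>0} e^{-y-z} \int_{0<a<=sqrt(tz)} Q(a, sqrt(sy)) da dy dz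
   is log-concave in (s,t), and Euler's integral gives
     W(s,t) = pi^{(n+1)/2} \sum_i V_i / omega_{i+1} s^{(n-i)/2} t^{(i+1)/2}.
   Up to a constant, W(s,1) = E s^{X/2} for X = I_K and W(1,s) = E s^{X/2} for
   X = n + 1 - I_K. The tangent at s = 1 of the concave function log E s^{X/2}
   yields E s^{X/2} <= exp((s - 1) E X / 2), and Chernoff's method then yields
   the tail bound with sigma^2 replaced by E X, for either choice of X. *)
Require Import Defs.
From mathcomp Require Import all_boot all_order all_algebra.
From mathcomp Require Import all_classical all_reals all_analysis.
From mathcomp Require Import measurable_realfun ring lra.
Import Order.TTheory GRing.Theory Num.Theory.
Import numFieldNormedType.Exports.
Set Implicit Arguments.
Unset Strict Implicit.
Unset Printing Implicit Defensive.
Local Open Scope classical_set_scope.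
Local Open Scope ring_scope.

(** * The Prekopa-Leindler inequality on the line *)

(** Log-concavity occurs only in the midpoint form F(u) F(v) <= F((u+v)/2)^2. This keeps the
    Prekopa-Leindler inequality free of real exponents, and it suffices at the end: the generating
    function F satisfies F(1) = 1, so halving the distance to 1 repeatedly does the work of the
    tangent line. The averages defining W repair constants: Q carries kappa_{n-i}, where
    1/omega_{i+1} is wanted. Averaging over y removes the Gamma factor of kappa_{n-i}; integrating
    over a and averaging over z creates omega_{i+1}. The integration over a also raises the degree
    by one, which is why delta is paired with n + 1 - delta. Steiner's formula for [K] and V_i >= 0
    are both extracted from the existence of a random variable with the prescribed law. *)

Lemma lebesgue_measure_affine (R : realType) (c b : R) (A : set R) :
  0 < c -> measurable A ->
  lebesgue_measure ((fun x => c * x + b) @^-1` A) =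
  ((c^-1)%:E * lebesgue_measure A)%E.
Proof.
move=> c0 mA.
have mf : measurable_fun [set: R] (fun x : R => c * x + b : measurableTypeR R).
  by apply: measurable_funD => //; exact: measurable_funM.
pose m := mscale (NngNum (ltW c0))
  (pushforward lebesgue_measure (fun x : R => c * x + b : measurableTypeR R)).
suff /(_ A mA) -> : forall A, measurable A -> lebesgue_measure A = m mf A.
  by rewrite /m /mscale /= muleA -EFinM mulVf ?mul1e// gt_eqF.
apply: lebesgue_measure_unique => _ [[x y]] _ <-.
transitivity (c%:E * lebesgue_measure
  ((fun z : R => c * z + b)%R @^-1` `]x, y]%classic))%E; last by [].
rewrite (_ : _ @^-1` _ = `]((x - b) / c), ((y - b) / c)]%classic); last first.
  apply/seteqP; split=> z /=; rewrite !in_itv/= ltr_pdivrMr// ler_pdivlMr//;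
  by rewrite ltrBlDr lerBrDr mulrC.
rewrite !lebesgue_measure_itv/= !lte_fin ltr_pM2r ?invr_gt0// ltrBlDr subrK.
case: ifPn => _; last by rewrite mule0.
by rewrite -!EFinD -EFinM; congr EFin; field; rewrite gt_eqF.
Qed.

(** Inner regularity reduces to compact sets, which have extreme points to translate by. Working
    with a measurable [C] that contains the midpoints avoids the question whether (A + B)/2 is
    measurable. *)
Lemma lebesgue_brunn_minkowski1 (R : realType) (A B C : set R) :
  measurable A -> measurable B -> measurable C -> A !=set0 -> B !=set0 ->
  (forall x y, A x -> B y -> C ((x + y) / 2)) ->
  (lebesgue_measure A + lebesgue_measure B <= 2%:E * lebesgue_measure C)%E.
Proof.
move=> mA mB mC [a Aa] [b Bb] ABC.
pose mu := @lebesgue_measure R.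
have compact_case (K L : set R) : compact K -> compact L -> K !=set0 ->
    L !=set0 -> K `<=` A -> L `<=` B -> (mu K + mu L <= 2%:E * mu C)%E.
  move=> cK cL K0 L0 KA LB.
  have [p /set_mem Kp pmax] :=
    compact_EVT_max K0 cK (continuous_subspaceT (fun x => @cvg_id _ (nbhs x))).
  have [q /set_mem Lq qmin] :=
    compact_EVT_min L0 cL (continuous_subspaceT (fun x => @cvg_id _ (nbhs x))).
  have mK := compact_measurable cK; have mL := compact_measurable cL.
  have maff (D : set R) (c : R) : measurable D ->
      measurable ((fun x => 2 * x + c) @^-1` D).
    move=> mD; rewrite -[X in measurable X]setTI.
    by apply: (measurable_funD _ _) => //; exact: measurable_funM.
  pose K' := (fun x => 2 * x + - q) @^-1` K.
  pose L' := (fun x => 2 * x + - p) @^-1` L.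
  have mK' : measurable K' by exact: maff.
  have mL' : measurable L' by exact: maff.
  have KE : (mu K = 2%:E * mu K')%E.
    by rewrite /mu lebesgue_measure_affine// muleA -EFinM divff// mul1e.
  have LE : (mu L = 2%:E * mu L')%E.
    by rewrite /mu lebesgue_measure_affine// muleA -EFinM divff// mul1e.
  (* [K'] and [L'] are the translates (K + q)/2 and (p + L)/2: both lie in [C]
     and they meet only at (p + q)/2. *)
  rewrite KE LE -ge0_muleDr//; apply: lee_wpmul2l => //.
  pose e : set R := [set (p + q) / 2].
  have -> : (mu K' = mu (K' `\` e))%E.
    apply/eqP; rewrite eq_le; apply/andP; split.
      rewrite -[leRHS]adde0 -(lebesgue_measure_set1 ((p + q) / 2)).
      apply: le_trans (outer_measureU2 _ _ _).
      apply: le_outer_measure => x K'x.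
      by have [->|/eqP xe] := eqVneq x ((p + q) / 2); [right|left].
    by apply: le_outer_measure; exact: subDsetl.
  have mKe : measurable (K' `\` e)
    by apply: measurableD => //; exact: measurable_set1.
  rewrite -measureU//; last first.
  - rewrite -subset0 => x [[K'x xe] L'x]; apply: xe.
    have := pmax (2 * x - q) (mem_set K'x).
    have := qmin (2 * x - p) (mem_set L'x).
    by rewrite /e /=; lra.
  apply: le_outer_measure => x [[K'x _]|L'x].
  - have := ABC _ _ (KA _ K'x) (LB _ Lq).
    by congr C; field.
  - have := ABC _ _ (KA _ Kp) (LB _ L'x).
    by congr C; field.
have cU (K : set R) (x : R) : compact K -> compact (x |` K).
  by move=> cK; apply: compactU => //; exact: compact_set1.
have xU (D : set R) (x : R) : (x |` D) !=set0 by exists x; left.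
have UD (D K : set R) x : K `<=` D -> D x -> x |` K `<=` D.
  by move=> KD Dx y [->|/KD].
(* The empty set is among the compact subsets in the supremum; adjoining [a] and [b] makes both sets
   nonempty without decreasing their measures. *)
have le_cU (K L : set R) : compact K -> compact L -> K `<=` A -> L `<=` B ->
    (mu K + mu L <= 2%:E * mu C)%E.
  move=> cK cL KA LB; apply: (@le_trans _ _ (mu (a |` K) + mu (b |` L))%E).
    by apply: leeD; apply: le_outer_measure; exact: subsetUr.
  by apply: compact_case; [exact: cU|exact: cU|exact: xU|exact: xU|exact: UD|exact: UD].
rewrite -/mu; have [->|Coo] := eqVneq (mu C) +oo%E; first by rewrite gt0_muley// leey.
have Cfin : (2%:E * mu C)%E \is a fin_num.
  by rewrite fin_numM// ge0_fin_numE// ltey.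
rewrite [in X in (X + _)%E]/mu (lebesgue_regularity_inner_sup mA).
rewrite [in X in (_ + X)%E]/mu (lebesgue_regularity_inner_sup mB).
rewrite -(lee_suber_addr _ _ Cfin); apply: ge_ereal_sup => _ [K [cK KA] <-].
rewrite lee_suber_addr// addeC -lee_suber_addr//.
apply: ge_ereal_sup => _ [L [cL LB] <-].
by rewrite lee_suber_addr// addeC; exact: le_cU.
Qed.

Lemma measurable_subgraph d (T : measurableType d) (R : realType)
    (f : T -> \bar R) : measurable_fun setT f ->
  measurable [set p : T * measurableTypeR R | (p.2%:E < f p.1)%E].
Proof.
move=> mf; have mF : measurable_fun setT
    (fun p : T * measurableTypeR R => f p.1 - p.2%:E)%E.
  apply: emeasurable_funB; first exact: measurableT_comp.
  by apply/measurable_EFinP; exact: measurable_snd.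
have := emeasurable_fun_o_infty measurableT mF 0%E; rewrite setTI.
by congr measurable; apply/seteqP; split=> -[x s] /=; rewrite EFinN sube_gt0.
Qed.

(** Both sides measure the region 0 < s < f(x) under the graph, sliced along either coordinate;
    Tonelli exchanges the slices. *)
Lemma layer_cake d (T : measurableType d) (R : realType)
    (mu : {sigma_finite_measure set T -> \bar R}) (f : T -> \bar R) :
  measurable_fun setT f -> (forall x, 0 <= f x)%E ->
  (\int[mu]_x f x =
   \int[lebesgue_measure]_(s in `]0%R, +oo[) mu [set x | s%:E < f x])%E.
Proof.
move=> mf f0.
pose G := [set p : T * measurableTypeR R | 0 < p.2] `&`
          [set p : T * measurableTypeR R | (p.2%:E < f p.1)%E].
have mG : measurable G.
  apply: measurableI; last exact: measurable_subgraph.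
  rewrite (_ : mkset _ = setT `&` (snd @^-1` `]0%R, +oo[%classic)).
    by apply: measurable_snd => //; exact: measurable_itv.
  by rewrite setTI; apply/seteqP; split=> -[x s] /=; rewrite in_itv/= andbT.
transitivity (\int[mu]_x \int[lebesgue_measure]_s (\1_G (x, s))%:E)%E.
  apply: eq_integral => x _.
  rewrite (_ : (fun s => _) = (fun s : measurableTypeR R =>
      (\1_[set s : R | 0 < s /\ (s%:E < f x)%E] s)%:E))//.
  rewrite integral_indic//=; last first.
    have := measurable_xsection x mG; congr measurable.
    by apply/seteqP; split=> s; rewrite /xsection/= inE.
  rewrite setIT; case: (f x) (f0 x) => [r r0| _|//].
    rewrite (_ : mkset _ = `]0%R, r[%classic); last first.
      apply/seteqP; split=> s /=; rewrite lte_fin in_itv/=.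
        by case=> s0 sr; rewrite s0.
      by move/andP.
    rewrite lebesgue_measure_itv/= lte_fin.
    move: r0; rewrite lee_fin le_eqVlt => /predU1P[<-|->].
      by rewrite ltxx.
    by rewrite -EFinD subr0.
  rewrite (_ : mkset _ = `]0%R, +oo[%classic); last first.
    apply/seteqP; split=> s /=; rewrite in_itv/= andbT ?ltry; first by case.
    by [].
  by rewrite lebesgue_measure_itv/= ltry.
rewrite (@fubini_tonelli _ _ _ _ _ mu lebesgue_measure
  (fun p => (\1_G p)%:E))//; last first.
  by apply/measurable_EFinP; exact: measurable_indic.
rewrite [RHS]integral_mkcond; apply: eq_integral => s _.
rewrite patchE; case: ifPn => [|]; rewrite ?inE ?notin_setE/= in_itv/= andbT.
  move=> s0.
  rewrite (_ : (fun x => _) = (fun x =>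
      (\1_[set x | (s%:E < f x)%E] x)%:E)); last first.
    apply/funext => x; rewrite !indicE.
    suff -> : ((x, s) \in G) = (x \in [set x | (s%:E < f x)%E]) by [].
    by apply/idP/idP; rewrite !inE/=; [case|split].
  rewrite integral_indic//= ?setIT//.
  have := emeasurable_fun_o_infty measurableT mf s%:E.
  by rewrite setTI.
move=> s0; apply: integral0_eq => x _.
by rewrite indicE memNset// => -[/= /s0].
Qed.

Lemma measurable_measure_superlevel d (T : measurableType d) (R : realType)
    (mu : {sigma_finite_measure set T -> \bar R}) (f : T -> \bar R)
    (D : set (measurableTypeR R)) : measurable_fun setT f ->
  measurable_fun D (fun s => mu [set x | (s%:E < f x)%E]).
Proof.
move=> mf; apply: measurable_funTS.
have := measurable_fun_ysection mu (measurable_subgraph mf).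
congr measurable_fun; apply/funext => s /=; congr (mu _).
by apply/seteqP; split=> x; rewrite /ysection/= inE.
Qed.

(** Equal suprema make the superlevel sets of [f] and [g] nonempty at the same heights, s < 1, so
    the Brunn-Minkowski inequality on the line applies level by level. The result is additive, which
    is stronger than the product form by AM-GM. *)
Lemma prekopa_leindler_normalized (R : realType) (f g h : R -> \bar R) :
  measurable_fun setT f -> measurable_fun setT g -> measurable_fun setT h ->
  (forall x, 0 <= f x)%E -> (forall x, 0 <= g x)%E -> (forall x, 0 <= h x)%E ->
  ereal_sup (range f) = 1%E -> ereal_sup (range g) = 1%E ->
  (forall x y, f x * g y <= h ((x + y) / 2)%R * h ((x + y) / 2)%R)%E ->
  (\int[lebesgue_measure]_x f x + \int[lebesgue_measure]_x g x <= 2%:E * \int[lebesgue_measure]_x h x)%E.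
Proof.
pose mu := @lebesgue_measure R.
move=> mf mg mh f0 g0 h0 supf supg fgh.
have lev (k : R -> \bar R) s : measurable_fun setT k ->
    measurable [set x | (s%:E < k x)%E].
  by move=> mk; have := emeasurable_fun_o_infty measurableT mk s%:E; rewrite setTI.
have mlev k : measurable_fun setT k ->
    measurable_fun (`]0%R, +oo[ : set R) (fun s => mu [set x | (s%:E < k x)%E]).
  by move=> mk; exact: measurable_measure_superlevel.
rewrite !layer_cake// -ge0_integralD//; [|exact: mlev..].
rewrite -ge0_integralZl//; [|exact: mlev].
apply: ge0_le_integral => //.
- by move=> s _; rewrite adde_ge0.
- by apply: emeasurable_funD; exact: mlev.
- by apply: emeasurable_funM => //; exact: mlev.
move=> s; rewrite /= in_itv/= andbT => s0.
have nonempty (k : R -> \bar R) : ereal_sup (range k) = 1%E -> s < 1 ->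
    [set x | (s%:E < k x)%E] !=set0.
  move=> supk s1; apply/set0P/negP => /eqP k0.
  have : (1 <= s%:E)%E; last by rewrite leNgt lte_fin s1.
  rewrite -supk; apply: ge_ereal_sup => _ [x _ <-]; rewrite leNgt; apply/negP.
  by move=> kx; rewrite -[False]/(set0 x) -k0.
have [s1|s1] := ltP s 1.
  apply: lebesgue_brunn_minkowski1; [exact: lev..| | |].
  - exact: nonempty.
  - exact: nonempty.
  - move=> x y /= sfx sgy; rewrite ltNge; apply/negP => hs.
    have := fgh x y; apply/negP; rewrite -ltNge.
    apply: (@le_lt_trans _ _ (s%:E * s%:E)%E).
      exact: lee_pmul.
    by apply: lte_pmul; rewrite ?lee_fin ?ltW.
have empty (k : R -> \bar R) : ereal_sup (range k) = 1%E ->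
    [set x | (s%:E < k x)%E] = set0.
  move=> supk; rewrite -subset0 => x /=; apply/negP; rewrite -leNgt.
  apply: (@le_trans _ _ 1%E); last by rewrite lee_fin.
  by rewrite -supk; apply: ereal_sup_ubound; exists x.
rewrite (empty f supf) (empty g supg).
have -> : lebesgue_measure (set0 : set R) = 0%E by exact: measure0.
by rewrite adde0 mule_ge0.
Qed.

Lemma prekopa_leindler_bounded (R : realType) (f g h : R -> \bar R) :
  measurable_fun setT f -> measurable_fun setT g -> measurable_fun setT h ->
  (forall x, 0 <= f x)%E -> (forall x, 0 <= g x)%E -> (forall x, 0 <= h x)%E ->
  (ereal_sup (range f) < +oo)%E -> (ereal_sup (range g) < +oo)%E ->
  (forall x y, f x * g y <= h ((x + y) / 2)%R * h ((x + y) / 2)%R)%E ->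
  ((\int[lebesgue_measure]_x f x) * (\int[lebesgue_measure]_x g x) <=
   (\int[lebesgue_measure]_x h x) * (\int[lebesgue_measure]_x h x))%E.
Proof.
pose mu := @lebesgue_measure R.
move=> mf mg mh f0 g0 h0 supf supg fgh.
have If : (0 <= \int[mu]_x f x)%E by exact: integral_ge0.
have Ig : (0 <= \int[mu]_x g x)%E by exact: integral_ge0.
have Ih : (0 <= \int[mu]_x h x)%E by exact: integral_ge0.
have sup_ge0 (k : R -> \bar R) : (forall x, 0 <= k x)%E ->
    (0 <= ereal_sup (range k))%E.
  by move=> k0; apply: le_trans (k0 0) _; apply: ereal_sup_ubound; exists 0.
have sup_eq0 (k : R -> \bar R) : (forall x, 0 <= k x)%E ->
    ereal_sup (range k) = 0%E -> (\int[mu]_x k x = 0)%E.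
  move=> k0 k_eq0; apply: integral0_eq => x _; apply/eqP.
  by rewrite eq_le k0 andbT -k_eq0; apply: ereal_sup_ubound; exists x.
have [f_eq0|supf0] := eqVneq (ereal_sup (range f)) 0%E.
  by rewrite (sup_eq0 f)// mul0e mule_ge0.
have [g_eq0|supg0] := eqVneq (ereal_sup (range g)) 0%E.
  by rewrite (sup_eq0 g)// mule0 mule_ge0.
have [->|hoo] := eqVneq (\int[mu]_x h x)%E +oo%E; first by rewrite mulyy leey.
have normalize (k : R -> \bar R) : (forall x, 0 <= k x)%E ->
    (ereal_sup (range k) < +oo)%E -> ereal_sup (range k) != 0%E ->
    exists2 m : R, 0 < m & ereal_sup (range (fun x => (m^-1)%:E * k x)%E) = 1%E.
  move=> k0 supk supk0; set M := ereal_sup (range k).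
  have Mfin : M \is a fin_num by rewrite ge0_fin_numE//; exact: sup_ge0.
  have M0 : 0 < fine M.
    by rewrite fine_gt0// supk andbT lt_neqAle eq_sym supk0; exact: sup_ge0.
  exists (fine M) => //; rewrite -[LHS](_ : (((fine M)^-1)%:E * M)%E = _).
    by rewrite -[X in (_ * X)%E]fineK// -EFinM mulVf// gt_eqF.
  rewrite -ereal_sup_pZl ?invr_gt0//; congr ereal_sup.
  by apply/seteqP; split=> [_ [_ [x _ <-] <-]|_ [x _ <-]]; [exists x|exists (k x) => //; exists x].
have [m m0 fm] := normalize f f0 supf supf0.
have [n n0 gn] := normalize g g0 supg supg0.
(* Dividing [f] by m, [g] by n and [h] by w preserves the pointwise hypothesis exactly when w^2 = m
   n. *)
pose w := Num.sqrt (m * n).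
have w0 : 0 < w by rewrite sqrtr_gt0 mulr_gt0.
have wE : w * w = m * n by rewrite -expr2 sqr_sqrtr// ltW// mulr_gt0.
have c0 (r : R) : 0 < r -> (0 <= (r^-1)%:E)%E.
  by move=> r0; rewrite lee_fin invr_ge0 ltW.
have := @prekopa_leindler_normalized R (fun x => (m^-1)%:E * f x)%E
  (fun x => (n^-1)%:E * g x)%E (fun x => (w^-1)%:E * h x)%E.
rewrite !ge0_integralZl// ?c0// => PL.
have {PL} : ((m^-1)%:E * (\int[mu]_x f x) + (n^-1)%:E * (\int[mu]_x g x) <=
    2%:E * ((w^-1)%:E * \int[mu]_x h x))%E.
  apply: PL => //.
  - by apply: emeasurable_funM.
  - by apply: emeasurable_funM.
  - by apply: emeasurable_funM.
  - by move=> x; rewrite mule_ge0// c0.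
  - by move=> x; rewrite mule_ge0// c0.
  - by move=> x; rewrite mule_ge0// c0.
  move=> x y; rewrite muleACA [leRHS]muleACA -!EFinM -!invfM wE.
  rewrite mulrC; apply: lee_wpmul2l => //; apply: c0; exact: mulr_gt0.
have : (\int[mu]_x h x)%E \is a fin_num by rewrite ge0_fin_numE// ltey.
case: (\int[mu]_x h x)%E => // c _ le_fgh.
have finite (r C : R) (X : \bar R) : 0 < r -> (0 <= X)%E ->
    (r%:E * X <= C%:E)%E -> X \is a fin_num.
  by move=> r0; case: X => //= _; rewrite gt0_muley ?lte_fin.
have If_fin : (\int[mu]_x f x)%E \is a fin_num.
  apply: (@finite m^-1 (2 * (w^-1 * c))) => //; first by rewrite invr_gt0.
  by apply: le_trans le_fgh; rewrite leeDl// mule_ge0// c0.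
have Ig_fin : (\int[mu]_x g x)%E \is a fin_num.
  apply: (@finite n^-1 (2 * (w^-1 * c))) => //; first by rewrite invr_gt0.
  by apply: le_trans le_fgh; rewrite leeDr// mule_ge0// c0.
move: If Ig le_fgh; rewrite -(fineK If_fin) -(fineK Ig_fin).
move: (fine _) (fine _) => b a; rewrite -!EFinM -!EFinD !lee_fin => a0 b0 le.
(* AM-GM: [4 (a/m) (b/n) <= (a/m + b/n)^2 <= 4 c^2 / (m n)] *)
have [u0 v0] : 0 <= m^-1 * a /\ 0 <= n^-1 * b.
  by split; rewrite mulr_ge0// invr_ge0 ltW.
have : (m^-1 * a + n^-1 * b) ^+ 2 <= (2 * (w^-1 * c)) ^+ 2.
  have uv0 := addr_ge0 u0 v0.
  by rewrite !expr2; exact: (ler_pM uv0 uv0 le le).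
have -> : a * b = (m * n) * ((m^-1 * a) * (n^-1 * b)).
  by field; rewrite !gt_eqF.
have -> : c * c = (m * n) * (w^-1 * c) ^+ 2.
  by rewrite -wE; field; rewrite gt_eqF.
move=> sq; rewrite ler_pM2l ?mulr_gt0//.
by have := sqr_ge0 (m^-1 * a - n^-1 * b); nra.
Qed.

(** The delicate case is x = +oo: either no element of [S] is positive and the supremum is 0, or one
    positive element already forces y = +oo. *)
Lemma mule_ereal_sup_le (R : realType) (S : set \bar R) (x y : \bar R) :
  S !=set0 -> (forall a, S a -> 0 <= a)%E -> (0 <= x)%E -> (0 <= y)%E ->
  (forall a, S a -> a * x <= y)%E -> (ereal_sup S * x <= y)%E.
Proof.
move=> S0 Sge0 + y0; case: x => [r|_ le|//].
  rewrite lee_fin le_eqVlt => /predU1P[<- _|r0 le]; first by rewrite mule0.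
  rewrite muleC -ereal_sup_pZl//; apply: ge_ereal_sup => _ [a Sa <-].
  by rewrite muleC; exact: le.
have [S_le0|] := pselect (forall a, S a -> (a <= 0)%E).
  suff -> : ereal_sup S = 0%E by rewrite mul0e.
  apply/eqP; rewrite eq_le ge_ereal_sup//=; case: S0 => a Sa.
  by apply: le_trans (Sge0 _ Sa) _; exact: ereal_sup_ubound.
move=> /existsNP[a /not_implyP[Sa /negP]]; rewrite -ltNge => a0.
by apply: le_trans (le _ Sa); rewrite [leRHS]gt0_muley// leey.
Qed.

(** Truncating [f] and [g] only weakens the pointwise hypothesis, and [h] stays fixed. The two
    truncation levels are independent, so monotone convergence lets the suprema be taken one after
    the other. *)
Lemma prekopa_leindler1 (R : realType) (f g h : R -> \bar R) :
  measurable_fun setT f -> measurable_fun setT g -> measurable_fun setT h ->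
  (forall x, 0 <= f x)%E -> (forall x, 0 <= g x)%E -> (forall x, 0 <= h x)%E ->
  (forall x y, f x * g y <= h ((x + y) / 2)%R * h ((x + y) / 2)%R)%E ->
  ((\int[lebesgue_measure]_x f x) * (\int[lebesgue_measure]_x g x) <=
   (\int[lebesgue_measure]_x h x) * (\int[lebesgue_measure]_x h x))%E.
Proof.
move=> mf mg mh f0 g0 h0 fgh; pose mu := @lebesgue_measure R.
pose trunc (k : R -> \bar R) (n : nat) x := mine (k x) n%:R%:E.
have mtrunc k n : measurable_fun setT k -> measurable_fun setT (trunc k n).
  by move=> mk; exact: measurable_mine.
have trunc_ge0 k n : (forall x, 0 <= k x)%E -> (forall x, 0 <= trunc k n x)%E.
  by move=> k0 x; rewrite le_min k0 lee_fin ler0n.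
have trunc_lty k n : (ereal_sup (range (trunc k n)) < +oo)%E.
  apply: (@le_lt_trans _ _ n%:R%:E); last by rewrite ltry.
  by apply: ge_ereal_sup => _ [x _ <-]; rewrite ge_min lexx orbT.
have trunc_le k n x : (trunc k n x <= k x)%E by rewrite ge_min lexx.
have sup_trunc k : measurable_fun setT k -> (forall x, 0 <= k x)%E ->
    (\int[mu]_x k x = ereal_sup (range (fun n => \int[mu]_x trunc k n x)))%E.
  move=> mk k0.
  have nd x : {homo (trunc k)^~ x : n m / (n <= m)%N >-> (n <= m)%E}.
    move=> n m nm; rewrite le_min ge_min lexx/= ge_min lee_fin ler_nat nm.
    by rewrite orbT.
  have lim_trunc x : limn ((trunc k)^~ x) = k x.
    apply/cvg_lim => //; rewrite /trunc.
    case: (k x) (k0 x) => [r _|_|//].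
      apply: cvg_near_cst; near=> n; apply/eqP.
      by rewrite minEle lee_fin ifT//; near: n; exact: nbhs_infty_ger.
    rewrite (_ : (fun n => _) = (fun n : nat => n%:R%:E)); last first.
      by apply/funext => n; rewrite minEle leye_eq.
    exact/cvgenyP.
  have := @cvg_monotone_convergence _ _ _ mu _ measurableT (trunc k)
    (fun n => mtrunc k n mk) (fun n x _ => trunc_ge0 k n k0 x)
    (fun x _ => nd x).
  under eq_integral do rewrite lim_trunc.
  move=> cvg_int; apply: (cvg_unique _ cvg_int) => //.
  apply: ereal_nondecreasing_cvgn => n p np; apply: ge0_le_integral => //.
  - by move=> x _; exact: trunc_ge0.
  - exact: mtrunc.
  - exact: mtrunc.
  - by move=> x _; exact: nd.
have bounded n p : ((\int[mu]_x trunc f n x) * (\int[mu]_x trunc g p x) <=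
    (\int[mu]_x h x) * (\int[mu]_x h x))%E.
  apply: prekopa_leindler_bounded; [exact: mtrunc|exact: mtrunc|by []
    |exact: trunc_ge0|exact: trunc_ge0|by []|by []|by []|].
  by move=> x y; apply: le_trans (fgh x y); apply: lee_pmul => //; exact: trunc_ge0.
have h2 : (0 <= (\int[mu]_x h x) * (\int[mu]_x h x))%E.
  by rewrite mule_ge0//; exact: integral_ge0.
rewrite -/mu (sup_trunc f)//; apply: mule_ereal_sup_le => //.
- by exists (\int[mu]_x trunc f 0%N x)%E; exists 0%N.
- by move=> _ [n _ <-]; apply: integral_ge0 => x _; exact: trunc_ge0.
- exact: integral_ge0.
move=> _ [n _ <-]; rewrite muleC (sup_trunc g)//; apply: mule_ereal_sup_le => //.
- by exists (\int[mu]_x trunc g 0%N x)%E; exists 0%N.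
- by move=> _ [p _ <-]; apply: integral_ge0 => x _; exact: trunc_ge0.
- by apply: integral_ge0 => x _; exact: trunc_ge0.
by move=> _ [p _ <-]; rewrite muleC.
Unshelve. all: by end_near. Qed.

(** * Products of the Lebesgue measure *)

Lemma lebesgue_integral_scale (R : realType) (c : R) (f : R -> \bar R) :
  0 < c -> measurable_fun setT f -> (forall x, 0 <= f x)%E ->
  (\int[lebesgue_measure]_x f (c * x)%R =
   (c^-1)%:E * \int[lebesgue_measure]_x f x)%E.
Proof.
move=> c0 mf f0.
have mc : measurable_fun [set: R] (fun x : R => c * x : measurableTypeR R).
  exact: measurable_funM.
have cV0 : 0 <= c^-1 by rewrite invr_ge0 ltW.
rewrite -[RHS](@ge0_integral_mscale _ _ _ lebesgue_measure _ measurableT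
  (NngNum cV0) f mf)//.
transitivity (\int[pushforward lebesgue_measure
    (fun x : R => (c * x)%R : measurableTypeR R)]_x f x)%E.
  by rewrite ge0_integral_pushforward// preimage_setT.
apply: eq_measure_integral => A mA _ /=.
rewrite /pushforward /mscale /= -(lebesgue_measure_affine 0 c0 mA).
by congr (lebesgue_measure _); apply/funext => x /=; rewrite addr0.
Qed.

Section lebesgue_tuple_theory.
Context {R : realType}.
Local Notation mu := (@lebesgue_tuple R).

Lemma lebesgue_tupleS n (A : set (n.+1.-tuple (measurableTypeR R))) :
  mu n.+1 A = (\int[lebesgue_measure]_x mu n [set t | A (tuple_cons (x, t))])%E.
Proof.
rewrite /= /lebesgue_cons /pushforward /product_measure1.
apply: eq_integral => x _ /=; congr (mu n _).
by apply/seteqP; split=> t; rewrite /xsection/= inE.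
Qed.

Lemma measurable_cons_section n (A : set (n.+1.-tuple (measurableTypeR R))) x :
  measurable A -> measurable [set t | A (tuple_cons (x, t))].
Proof.
move=> mA.
have mA' : measurable (@tuple_cons R n @^-1` A).
  by rewrite -[X in measurable X]setTI; exact: measurable_tuple_cons.
have := measurable_xsection x mA'; congr measurable.
by apply/seteqP; split=> t; rewrite /xsection/= inE.
Qed.

Lemma measurable_fun_cons_section n (A : set (n.+1.-tuple (measurableTypeR R))) :
  measurable A ->
  measurable_fun [set: R] (fun x => mu n [set t | A (tuple_cons (x, t))]).
Proof.
move=> mA.
have mA' : measurable (@tuple_cons R n @^-1` A).
  by rewrite -[X in measurable X]setTI; exact: measurable_tuple_cons.
have := measurable_fun_xsection (mu n) mA'; congr measurable_fun.
apply/funext => x /=; congr (mu n _).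
by apply/seteqP; split=> t; rewrite /xsection/= inE.
Qed.

Definition tuple_midpoint n (s t : n.-tuple R) : n.-tuple R :=
  [tuple (tnth s i + tnth t i) / 2 | i < n].

Lemma tuple_midpoint_cons n (x y : R) (s t : n.-tuple R) :
  tuple_midpoint (tuple_cons (x, s)) (tuple_cons (y, t)) =
  tuple_cons ((x + y) / 2, tuple_midpoint s t).
Proof.
apply: eq_from_tnth => i; rewrite tnth_mktuple.
by case: (unliftP ord0 i) => [j ->|->]; rewrite !(tnthS, tnth0)// tnth_mktuple.
Qed.

(** Induction on the dimension: the measures of the sections are functions of the first coordinate,
    and the induction hypothesis is exactly the pointwise assumption of [prekopa_leindler1] for
    them. The product form tolerates empty sections. *)
Lemma lebesgue_tuple_brunn_minkowski n
    (A B C : set (n.-tuple (measurableTypeR R))) :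
  measurable A -> measurable B -> measurable C ->
  (forall s t, A s -> B t -> C (tuple_midpoint s t)) ->
  (mu n A * mu n B <= mu n C * mu n C)%E.
Proof.
elim: n A B C => [|n IH] A B C mA mB mC ABC.
  rewrite /= !diracE.
  have [/set_mem A0|_] := boolP ([tuple] \in A); last first.
    by rewrite mul0e mule_ge0// lee_fin.
  have [/set_mem B0|_] := boolP ([tuple] \in B); last first.
    by rewrite mule0 mule_ge0// lee_fin.
  rewrite (_ : [tuple] \in C = true)//; apply/mem_set.
  by rewrite [X in C X](_ : _ = tuple_midpoint [tuple] [tuple]) ?[LHS]tuple0 ?[RHS]tuple0//; exact: ABC.
rewrite !lebesgue_tupleS; apply: prekopa_leindler1.
- exact: measurable_fun_cons_section.
- exact: measurable_fun_cons_section.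
- exact: measurable_fun_cons_section.
- by [].
- by [].
- by [].
move=> x y; apply: IH.
- exact: measurable_cons_section.
- exact: measurable_cons_section.
- exact: measurable_cons_section.
by move=> s t /= As Bt; rewrite -tuple_midpoint_cons; exact: ABC.
Qed.

Definition tuple_scale n (c : R) (t : n.-tuple R) : n.-tuple R :=
  [tuple c * tnth t i | i < n].

Lemma tuple_scale_cons n (c x : R) (t : n.-tuple R) :
  tuple_scale c (tuple_cons (x, t)) = tuple_cons (c * x, tuple_scale c t).
Proof.
apply: eq_from_tnth => i; rewrite tnth_mktuple.
by case: (unliftP ord0 i) => [j ->|->]; rewrite !(tnthS, tnth0)// tnth_mktuple.
Qed.

Lemma lebesgue_tuple_scale n (c : R) (A : set (n.-tuple (measurableTypeR R))) :
  0 < c -> measurable A ->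
  (mu n (tuple_scale c @^-1` A) = (c^-1 ^+ n)%:E * mu n A)%E.
Proof.
move=> c0; elim: n A => [|n IH] A mA.
  rewrite expr0 mul1e; congr (mu 0 _); apply/funext => t /=.
  by congr (A _); rewrite [LHS]tuple0 [RHS]tuple0.
rewrite !lebesgue_tupleS.
under eq_integral => x _.
  rewrite (_ : mkset _ = tuple_scale c @^-1` [set t | A (tuple_cons (c * x, t))]);
    last by apply/funext => t /=; rewrite tuple_scale_cons.
  rewrite IH; last exact: measurable_cons_section.
  over.
have msec := measurable_fun_cons_section mA.
have cn0 : (0 <= (c^-1 ^+ n)%:E)%E by rewrite lee_fin exprn_ge0// invr_ge0 ltW.
rewrite (@lebesgue_integral_scale _ c (fun x => (c^-1 ^+ n)%:E *
  mu n [set t | A (tuple_cons (x, t))])%E)//.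
- by rewrite ge0_integralZl// muleA -EFinM -exprS.
- exact: emeasurable_funM.
- by move=> x; rewrite mule_ge0.
Qed.

End lebesgue_tuple_theory.

(** * Parallel bodies *)

(** Tuples carry a product sigma-algebra and rows a topology; the link is that an open set is the
    union of the countably many rational boxes it contains. *)
Lemma measurable_open_tuple (R : realType) n (U : set 'rV[R]_n) :
  open U ->
  measurable [set t : n.-tuple (measurableTypeR R) | U (\row_i tnth t i)].
Proof.
move=> oU.
pose box (p : 'rV[rat]_n * nat) : set 'rV[R]_n :=
  [set y | forall i, `|ratr (p.1 ord0 i) - y ord0 i| < p.2.+1%:R^-1].
pose B p : set (n.-tuple (measurableTypeR R)) :=
  if pselect (box p `<=` U) then [set t | box p (\row_i tnth t i)] else set0.
suff -> : [set t | U (\row_i tnth t i)] = \bigcup_p B p.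
  apply: countable_bigcupT_measurable; first exact: countableP.
  move=> p; rewrite /B; case: pselect => [pU|_] /=; last exact: measurable0.
  rewrite (_ : mkset _ = \bigcap_(i in [set: 'I_n]) [set t |
      ball (ratr (p.1 ord0 i) : R) p.2.+1%:R^-1 (tnth t i)]); last first.
    apply/seteqP; split=> t /= tp i; first by move=> _; have := tp i; rewrite mxE.
    by rewrite mxE; exact: tp.
  apply: fin_bigcap_measurable => // i _.
  rewrite -[X in measurable X]setTI.
  exact: (measurable_tnth i measurableT (measurable_ball _ _)).
apply/seteqP; split=> [t Ut|t [p _]]; last first.
  by rewrite /B; case: pselect => // pU; exact: pU.
move: Ut => /=; set x := \row_i _ => Ux.
have [e /= e0 xeU] : nbhs_ball x U by apply/nbhs_ballP; exact: open_nbhs_nbhs.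
(* Half of [e]: a point of the box is within 1/(k+1) of the rational centre, itself within 1/(k+1)
   of [x]. *)
have [k ke] : exists k : nat, k.+1%:R^-1 < e / 2.
  have e2 : 0 < e / 2 by rewrite divr_gt0.
  have [k _ /(_ k (leqnn k)) kE] := near_infty_natSinv_lt (PosNum e2).
  by exists k.
have k0 : 0 < k.+1%:R^-1 :> R by [].
have approx (i : 'I_n) : exists r : rat, `|ratr r - x ord0 i| < k.+1%:R^-1.
  have [|r] := @rat_in_itvoo R (x ord0 i - k.+1%:R^-1) (x ord0 i + k.+1%:R^-1).
    by rewrite ltrBlDr -addrA ltrDl addr_gt0.
  by rewrite in_itv/= => ?; exists r; rewrite ltr_distl.
have [q qx] := boolp.choice approx.
exists (\row_i q i, k) => //; rewrite /B; case: pselect => [_|[]] /=.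
  by move=> i; have := qx i; rewrite /x !mxE.
move=> y /= qy; apply: xeU; split=> // i j; rewrite ord1 /ball/=.
rewrite -(subrK (ratr (q j)) (x _ _)) -addrA [e]splitr.
apply: le_lt_trans (ler_normD _ _) _; apply: ltrD; apply: lt_trans ke.
  by rewrite distrC.
by have := qy j; rewrite mxE.
Qed.

Lemma measurable_compact_tuple (R : realType) n (C : set 'rV[R]_n) :
  compact C ->
  measurable [set t : n.-tuple (measurableTypeR R) | C (\row_i tnth t i)].
Proof.
move=> cC.
have clC : closed C by exact: (compact_closed (@norm_hausdorff R 'rV[R]_n) cC).
rewrite -[X in measurable X]setCK; apply: measurableC.
exact: (measurable_open_tuple (closed_openC clC)).
Qed.

Section parallel_bodies.
Context {R : realType} {n : nat}.
Implicit Types (K : set 'rV[R]_n) (a b : R).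

Lemma unit_ballE (y : 'rV[R]_n) :
  unit_ball y = (\sum_i y ord0 i ^+ 2 <= 1) :> Prop.
Proof.
have S0 : 0 <= \sum_i y ord0 i ^+ 2 by apply: sumr_ge0 => i _; exact: sqr_ge0.
by rewrite /unit_ball /= -[X in _ <= X]sqrtr1 ler_sqrt.
Qed.

Lemma compact_unit_ball : compact (@unit_ball R n).
Proof.
apply: bounded_closed_compact.
  exists 1; split; first by rewrite num_real.
  move=> M M1 y; rewrite unit_ballE => y1; apply: le_trans (ltW M1).
  rewrite [leLHS]/Num.norm/= mx_normrE; apply/bigmax_leP; split=> // -[i j] _ /=.
  rewrite ord1 -(@expr_le1 _ 2)// real_normK ?num_real//.
  apply: le_trans y1; rewrite (bigD1 j)//= lerDl.
  by apply: sumr_ge0 => k _; exact: sqr_ge0.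
rewrite (_ : unit_ball = (fun y : 'rV[R]_n => \sum_i y ord0 i ^+ 2) @^-1`
    `]-oo, 1]%classic); last first.
  by apply/funext => y; rewrite unit_ballE /= in_itv/=.
apply: closed_comp; last exact: interval_closed.
have sum_continuous (s : seq 'I_n) :
    continuous (fun y : 'rV[R]_n => \sum_(i <- s) y ord0 i ^+ 2).
  elim: s => [|i s IH].
    rewrite (_ : (fun y : 'rV[R]_n => _) = cst 0); first exact: cst_continuous.
    by apply/funext => z; rewrite big_nil.
  rewrite (_ : (fun y : 'rV[R]_n => _) = (fun y : 'rV[R]_n =>
      y ord0 i * y ord0 i + \sum_(j <- s) y ord0 j ^+ 2)); last first.
    by apply/funext => z; rewrite big_cons expr2.
  move=> y; have yi := @coord_continuous R 1 n ord0 i y.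
  exact: (cvgD (cvgM yi yi) (IH y)).
by move=> y _; exact: sum_continuous.
Qed.

Lemma convex_unit_ball (p q : R) (x y : 'rV[R]_n) : 0 <= p -> 0 <= q ->
  p + q = 1 -> unit_ball x -> unit_ball y -> unit_ball (p *: x + q *: y).
Proof.
move=> p0 q0 pq; rewrite !unit_ballE => x1 y1.
apply: (@le_trans _ _ (p * (\sum_i x ord0 i ^+ 2) + q * (\sum_i y ord0 i ^+ 2))).
  rewrite !mulr_sumr -big_split/=; apply: ler_sum => i _; rewrite !mxE.
  have -> : q = 1 - p by rewrite -pq addrAC subrr add0r.
  (* For p + q = 1, p x^2 + q y^2 - (p x + q y)^2 = p q (x - y)^2. *)
  have := mulr_ge0 (mulr_ge0 p0 q0) (sqr_ge0 (x ord0 i - y ord0 i)).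
  have -> : q = 1 - p by rewrite -pq addrAC subrr add0r.
  by move=> ?; nra.
by rewrite -pq; apply: lerD; rewrite -[leRHS]mulr1; exact: ler_wpM2l.
Qed.

Lemma convex_body_comb K (p q : R) (x y : 'rV[R]_n) : convex_body K ->
  0 <= p -> 0 <= q -> p + q = 1 -> K x -> K y -> K (p *: x + q *: y).
Proof.
move=> [_ cK] p0 q0 pq Kx Ky.
have p1 : p <= 1 by rewrite -pq lerDl.
have := cK x y (Itv01 p0 p1) (mem_set Kx) (mem_set Ky) => /set_mem.
by have -> : q = 1 - p by rewrite -pq addrAC subrr add0r.
Qed.

Definition scaled_sum K a b : set 'rV[R]_n :=
  [set a *: x + b *: y | x in K & y in unit_ball].

Lemma measurable_scaled_sum K a b : convex_body K ->
  measurable [set t : n.-tuple (measurableTypeR R) |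
    scaled_sum K a b (\row_i tnth t i)].
Proof.
move=> [cK _]; apply: measurable_compact_tuple.
have -> : scaled_sum K a b =
    [set a *: p.1 + b *: p.2 | p in K `*` unit_ball].
  apply/seteqP; split=> [_ [x Kx [y By <-]]|_ [[x y] [Kx By] <-]].
    by exists (x, y).
  by exists x => //; exists y.
apply: continuous_compact; last by apply: compact_setX => //; exact: compact_unit_ball.
apply: continuous_subspaceT => -[x y].
by apply: cvgD; apply: cvgZr; [exact: cvg_fst|exact: cvg_snd].
Qed.

(** aK + bB is the dilate by a of the parallel body at distance b/a, which brings the two-parameter
    volume back to Steiner's formula. *)
Lemma volume_scaled_sum K a b : convex_body K -> 0 < a ->
  volume (scaled_sum K a b) =
  ((a ^+ n)%:E * volume (parallel_body K (b / a)))%E.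
Proof.
move=> cK a0.
have -> : parallel_body K (b / a) = scaled_sum K 1 (b / a).
  by apply/seteqP; split=> _ [x Kx [y By <-]]; exists x => //; exists y => //;
    rewrite scale1r.
rewrite /volume -[X in (X ^+ n)%:E]invrK -(@lebesgue_tuple_scale R n a^-1) ?invr_gt0//;
  last exact: measurable_scaled_sum.
congr (lebesgue_tuple n _); apply/funext => t /=; apply/propext.
have -> : \row_i tnth (tuple_scale a^-1 t) i = a^-1 *: \row_i tnth t i.
  by apply/rowP => i; rewrite !mxE tnth_mktuple.
have an0 : a != 0 by rewrite gt_eqF.
split=> -[x Kx [y By]].
- move=> <-; exists x => //; exists y => //.
  by rewrite scalerDr !scalerA mulVf// mulrC.
- move=> xyE; exists x => //; exists y => //.
  rewrite -[RHS]scale1r -(divff an0) -scalerA -xyE scalerDr !scalerA mulr1.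
  by rewrite mulrC divfK.
Qed.

(** By convexity a x + a' x' = (a + a') x'' with x'' in [K], and likewise in the ball, so midpoints
    of the two sums lie in the third set. *)
Lemma volume_scaled_sum_brunn_minkowski K a b a' b' : convex_body K ->
  0 < a -> 0 < a' -> 0 <= b -> 0 <= b' ->
  (volume (scaled_sum K a b) * volume (scaled_sum K a' b') <=
   volume (scaled_sum K ((a + a') / 2) ((b + b') / 2)) *
   volume (scaled_sum K ((a + a') / 2) ((b + b') / 2)))%E.
Proof.
move=> cK a0 a'0 b0 b'0.
apply: lebesgue_tuple_brunn_minkowski; [exact: measurable_scaled_sum..|].
move=> s t [x Kx [y By xyE]] [x' Kx' [y' By' xyE']] /=.
have -> : \row_i tnth (tuple_midpoint s t) i =
    2^-1 *: (\row_i tnth s i + \row_i tnth t i).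
  by apply/rowP => i; rewrite !mxE tnth_mktuple mulrC.
rewrite -xyE -xyE'.
have aa0 : 0 < a + a' by exact: addr_gt0.
exists ((a / (a + a')) *: x + (a' / (a + a')) *: x').
  apply: convex_body_comb => //; rewrite ?divr_ge0 ?ltW//.
  by rewrite -mulrDl divff// gt_eqF.
(* The weights b/(b + b') are meaningless when b + b' = 0; then b = b' = 0 and any point of the ball
   serves. *)
have [bb0|bb0] := eqVneq (b + b') 0.
  exists y => //; have [-> ->] : b = 0 /\ b' = 0.
    by move/eqP: bb0; rewrite paddr_eq0// => /andP[/eqP -> /eqP ->].
  apply/rowP => i; rewrite !mxE; field.
  by rewrite gt_eqF.
exists ((b / (b + b')) *: y + (b' / (b + b')) *: y').
  apply: convex_unit_ball => //; rewrite ?divr_ge0 ?addr_ge0//.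
  by rewrite -mulrDl divff.
apply/rowP => i; rewrite !mxE; field.
by rewrite bb0 gt_eqF.
Qed.

End parallel_bodies.

(** * Averages against Euler's integral *)

(** The functions are extended by zero: the left side of the pointwise inequality vanishes unless
    [x] is in [D] and [y] in [E]. *)
Lemma prekopa_leindler_on (R : realType) (D E F : set R) (f g h : R -> R) :
  measurable D -> measurable E -> measurable F ->
  measurable_fun D f -> measurable_fun E g -> measurable_fun F h ->
  (forall x, D x -> 0 <= f x) -> (forall x, E x -> 0 <= g x) ->
  (forall x, F x -> 0 <= h x) ->
  (forall x y, D x -> E y -> F ((x + y) / 2)) ->
  (forall x y, D x -> E y -> f x * g y <= h ((x + y) / 2) ^+ 2) ->
  ((\int[lebesgue_measure]_(x in D) (f x)%:E) *
   (\int[lebesgue_measure]_(x in E) (g x)%:E) <=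
   (\int[lebesgue_measure]_(x in F) (h x)%:E) *
   (\int[lebesgue_measure]_(x in F) (h x)%:E))%E.
Proof.
move=> mD mE mF mf mg mh f0 g0 h0 DEF fgh.
rewrite [in X in (X * _)%E]integral_mkcond [in X in (_ * X <= _)%E]integral_mkcond.
rewrite [in leRHS]integral_mkcond.
have restr_ge0 (A : set R) (k : R -> R) : (forall x, A x -> 0 <= k x) ->
    forall x, (0 <= ((fun x => (k x)%:E) \_ A) x)%E.
  by move=> k0 x; apply: erestrict_ge0 => y Ay; rewrite lee_fin k0.
apply: prekopa_leindler1; [| | |exact: restr_ge0..|].
- by apply/(measurable_restrictT _ _).1 => //; exact/measurable_EFinP.
- by apply/(measurable_restrictT _ _).1 => //; exact/measurable_EFinP.
- by apply/(measurable_restrictT _ _).1 => //; exact/measurable_EFinP.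
move=> x y; rewrite [X in (X * _)%E]patchE.
case: ifPn => [/set_mem Dx|_]; last first.
  by rewrite mul0e mule_ge0//; exact: restr_ge0.
rewrite [X in (_ * X <= _)%E]patchE; case: ifPn => [/set_mem Ey|_]; last first.
  by rewrite mule0 mule_ge0//; exact: restr_ge0.
by rewrite patchE mem_set ?lee_fin -?expr2; [exact: fgh|exact: DEF].
Qed.

Section gamma.
Context {R : realType}.

Lemma sqrtrX_powR (x : R) (k : nat) : 0 <= x ->
  Num.sqrt x ^+ k = x `^ (k%:R / 2).
Proof.
by move=> x0; rewrite mulrC powRrM powR12_sqrt// powR_mulrn// sqrtr_ge0.
Qed.

(** A crude domination for Euler's integral that uses up half of the exponential decay. With u =
    sqrt(x)^k, u <= 1 + u^2, and u^2 = x^k is controlled by one term of the exponential series at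
    x/2. *)
Lemma powR_half_le_expR (x : R) (k : nat) : 0 <= x ->
  x `^ (k%:R / 2) <= (1 + 2 ^+ k * k`!%:R) * expR (x / 2).
Proof.
move=> x0; have x20 : 0 <= x / 2 by rewrite divr_ge0.
have e1 : 1 <= expR (x / 2) by apply: le_trans (expR_ge1Dx _); rewrite lerDl.
have xk : x ^+ k <= 2 ^+ k * k`!%:R * expR (x / 2).
  case: k => [|k]; first by rewrite !expr0 fact0 !mul1r.
  have := expR_ge1Dxn k x20; rewrite expr_div_n => le.
  have P0 : 0 < 2 ^+ k.+1 :> R by rewrite exprn_gt0.
  have f0 : 0 < (k.+1)`!%:R :> R by rewrite ltr0n fact_gt0.
  rewrite -ler_pdivrMl ?mulr_gt0//; apply: le_trans le.
  rewrite (_ : _^-1 * _ = x ^+ k.+1 / 2 ^+ k.+1 / (k.+1)`!%:R) ?lerDr//.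
  by rewrite [LHS]mulrC invfM mulrA.
rewrite -sqrtrX_powR// mulrDl mul1r.
have := sqr_ge0 (Num.sqrt x ^+ k - 1).
have : (Num.sqrt x ^+ k) ^+ 2 = x ^+ k by rewrite exprAC sqr_sqrtr.
have := exprn_ge0 k (sqrtr_ge0 x).
move: (Num.sqrt x ^+ k) => u u0 uE.
by nra.
Qed.

Lemma measurable_powR_expRN (D : set R) (k : nat) :
  measurable_fun D (fun x : R => x `^ (k%:R / 2) * expR (- x)).
Proof.
apply: measurable_funTS; apply: measurable_funM.
  exact: measurable_powR.
by apply: measurableT_comp; [exact: measurable_expR|exact: oppr_measurable].
Qed.

Lemma powR_expRN_ge0 (k : nat) (x : R) :
  (0 <= (x `^ (k%:R / 2) * expR (- x))%:E)%E.
Proof. by rewrite lee_fin mulr_ge0// ?powR_ge0// expR_ge0. Qed.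

(** [Gamma] is a real-valued integral, the [fine] part of the extended one, so the identity amounts
    to finiteness. The integrand is dominated by a multiple of the exponential density of rate
    1/2. *)
Lemma integral_powR_expRN (k : nat) :
  (\int[lebesgue_measure]_(x in `]0%R, +oo[) (x `^ (k%:R / 2) * expR (- x))%:E =
   (Gamma (1 + k%:R / 2) : R)%:E)%E.
Proof.
rewrite /Gamma /Rintegral.
have -> : 1 + k%:R / 2 - 1 = k%:R / 2 :> R by rewrite addrAC subrr add0r.
rewrite fineK//.
rewrite ge0_fin_numE; last by apply: integral_ge0 => x _; exact: powR_expRN_ge0.
pose C : R := 2 * (1 + 2 ^+ k * k`!%:R).
have C0 : 0 <= C by rewrite mulr_ge0// addr_ge0// mulr_ge0// exprn_ge0.
have mpdf (D : set R) : measurable_fun D (EFin \o @exponential_pdf R 2^-1).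
  by apply: measurable_funTS; apply/measurable_EFinP; exact: measurable_exponential_pdf.
have pdf_ge0 x : (0 <= (exponential_pdf 2^-1 x : R)%:E)%E.
  by rewrite lee_fin exponential_pdf_ge0.
apply: (@le_lt_trans _ _ (\int[lebesgue_measure]_(x in `]0%R, +oo[)
    (C%:E * (exponential_pdf 2^-1 x)%:E))%E).
  apply: ge0_le_integral => //.
  - by move=> x x0; exact: powR_expRN_ge0.
  - by apply/measurable_EFinP; exact: measurable_powR_expRN.
  - by apply: emeasurable_funM => //; exact: mpdf.
  - move=> x /=; rewrite in_itv/= andbT => x0.
    rewrite -EFinM lee_fin exponential_pdfE; last exact: ltW.
    have -> : C * (2^-1 * expR (- 2^-1 * x)) =
        (1 + 2 ^+ k * k`!%:R) * expR (x / 2) * expR (- x).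
      rewrite -[in RHS]mulrA -expRD /C.
      rewrite [in RHS](_ : x / 2 - x = - 2^-1 * x); last by field.
      by field.
    rewrite ler_pM2r ?expR_gt0//.
    by apply: powR_half_le_expR; exact: ltW.
rewrite ge0_integralZl//; [|exact: mpdf].
apply: (@le_lt_trans _ _ (C%:E * 1%:E)%E); last by rewrite -EFinM ltry.
apply: lee_wpmul2l; first by rewrite lee_fin.
rewrite -(@integral_exponential_pdf R 2^-1)//.
by apply: ge0_subset_integral => //; exact: mpdf.
Qed.

Lemma Gamma_gt0 (k : nat) : 0 < Gamma (1 + k%:R / 2) :> R.
Proof.
rewrite -lte_fin -integral_powR_expRN.
(* On [1, 2] the power is at least 1 and the exponential at least e^{-2}. *)
apply: (@lt_le_trans _ _ (\int[lebesgue_measure]_(x in `[1%R, 2%R]) (expR (-2))%:E)%E).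
  rewrite integral_cst//= lebesgue_measure_itv/= lte_fin ltr1n -EFinB -EFinM.
  by rewrite lte_fin mulr_gt0// ?expR_gt0// subr_gt0 ltr1n.
apply: (@le_trans _ _ (\int[lebesgue_measure]_(x in `[1%R, 2%R])
    (x `^ (k%:R / 2) * expR (- x))%:E)%E).
  apply: ge0_le_integral => //.
  - by apply/measurable_EFinP; exact: measurable_powR_expRN.
  - move=> x /=; rewrite in_itv/= => /andP[x1 x2].
    rewrite lee_fin -[leLHS]mul1r; apply: ler_pM => //.
    + by rewrite -[leLHS](powRr0 x); apply: ler_powR => //; rewrite divr_ge0.
    + by rewrite ler_expR lerN2.
apply: ge0_subset_integral => //.
  by apply/measurable_EFinP; exact: measurable_powR_expRN.
  by move=> x ?; exact: powR_expRN_ge0.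
move=> x /=; rewrite !in_itv/= andbT => /andP[x1 _].
exact: lt_le_trans x1.
Qed.

End gamma.

Section exponential_average.
Context {R : realType} {m : nat} (e : 'I_m -> nat).

(** The exponents are a parameter because index i has exponent n - i in the ball variable and i + 1
    in the body variable. *)
Definition spoly (p : 'I_m -> R) (x : R) : R := \sum_i p i * x ^+ e i.

Lemma spoly_ge0 p x : (forall i, 0 <= p i) -> 0 <= x -> 0 <= spoly p x.
Proof. by move=> p0 x0; apply: sumr_ge0 => i _; rewrite mulr_ge0// exprn_ge0. Qed.

Lemma ler_spoly p x y : (forall i, 0 <= p i) -> 0 <= x -> x <= y ->
  spoly p x <= spoly p y.
Proof.
move=> p0 x0 xy; apply: ler_sum => i _; apply: ler_wpM2l => //.
by apply: lerXn2r => //; rewrite nnegrE// (le_trans x0).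
Qed.

(** The effect on coefficients of averaging f(sqrt(s x)) against e^{-x} dx, the average being read
    as a polynomial in sqrt(s). *)
Definition gamma_transform (p : 'I_m -> R) : 'I_m -> R :=
  fun i => p i * Gamma (1 + (e i)%:R / 2).

Lemma integral_spoly_sqrt p (s : R) : (forall i, 0 <= p i) -> 0 <= s ->
  (\int[lebesgue_measure]_(x in `]0%R, +oo[)
     (spoly p (Num.sqrt (s * x)) * expR (- x))%:E =
   (spoly (gamma_transform p) (Num.sqrt s))%:E)%E.
Proof.
move=> p0 s0.
transitivity (\int[lebesgue_measure]_(x in `]0%R, +oo[) (\sum_i
    (p i * Num.sqrt s ^+ e i)%:E * (x `^ ((e i)%:R / 2) * expR (- x))%:E)%E)%E.
  apply: eq_integral => x /[!inE]/= /[!in_itv]/= /[!andbT] x0.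
  rewrite mulr_suml sumEFin; congr EFin; apply: eq_bigr => i _.
  by rewrite sqrtrM// exprMn -sqrtrX_powR ?ltW// !mulrA.
have c0 i : (0 <= (p i * Num.sqrt s ^+ e i)%:E)%E.
  by rewrite lee_fin mulr_ge0// exprn_ge0// sqrtr_ge0.
rewrite ge0_integral_sum//.
- rewrite /spoly -sumEFin; apply: eq_bigr => i _.
  rewrite ge0_integralZl//.
  + by rewrite integral_powR_expRN -EFinM mulrAC.
  + by apply/measurable_EFinP; exact: measurable_powR_expRN.
  + by move=> x ?; exact: powR_expRN_ge0.
- move=> i; apply: emeasurable_funM => //.
  by apply/measurable_EFinP; exact: measurable_powR_expRN.
- by move=> i x ?; rewrite mule_ge0//; exact: powR_expRN_ge0.
Qed.

Lemma sqrtr_midpoint (s s' x y : R) : 0 <= s -> 0 <= s' -> 0 <= x -> 0 <= y ->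
  (Num.sqrt (s * x) + Num.sqrt (s' * y)) / 2 <=
  Num.sqrt ((s + s') / 2 * ((x + y) / 2)).
Proof.
move=> s0 s'0 x0 y0.
rewrite (sqrtrM _ s0) (sqrtrM _ s'0) -[leLHS]ger0_norm; last first.
  by rewrite divr_ge0// addr_ge0// mulr_ge0// sqrtr_ge0.
rewrite -sqrtr_sqr ler_sqrt; last first.
  by apply: mulr_ge0; rewrite divr_ge0// addr_ge0.
rewrite -[in leRHS](sqr_sqrtr s0) -[in leRHS](sqr_sqrtr s'0).
rewrite -[in leRHS](sqr_sqrtr x0) -[in leRHS](sqr_sqrtr y0).
move: (Num.sqrt s) (Num.sqrt s') (Num.sqrt x) (Num.sqrt y) => a b c d.
(* Lagrange's identity for the vectors (a, b) and (c, d). *)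
rewrite [leRHS](_ : _ = ((a * c + b * d) / 2) ^+ 2 + ((a * d - b * c) / 2) ^+ 2).
  by rewrite lerDl sqr_ge0.
by field.
Qed.

Lemma measurable_spoly_sqrt p (s : R) (D : set R) :
  measurable_fun D (fun x : R => spoly p (Num.sqrt (s * x)) * expR (- x)).
Proof.
apply: measurable_funTS; apply: measurable_funM; last first.
  by apply: measurableT_comp; [exact: measurable_expR|exact: oppr_measurable].
apply: measurable_sum => i; apply: measurable_funM => //.
apply: measurable_funX; apply: measurableT_comp.
  by apply: continuous_measurable_fun; exact: sqrt_continuous.
exact: measurable_funM.
Qed.

(** The weight e^{-x} is log-affine, hence neutral, and nonnegative coefficients make [spoly r]
    nondecreasing, so the concavity of sqrt(s x) can be inserted into it. There are three
    coefficient families because the coefficients depend on the other variable, which moves at the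
    same time. *)
Lemma gamma_transform_midpoint (p q r : 'I_m -> R) (s s' : R) :
  (forall i, 0 <= p i) -> (forall i, 0 <= q i) -> (forall i, 0 <= r i) ->
  (forall x y, 0 < x -> 0 < y ->
    spoly p x * spoly q y <= spoly r ((x + y) / 2) ^+ 2) ->
  0 < s -> 0 < s' ->
  spoly (gamma_transform p) (Num.sqrt s) *
  spoly (gamma_transform q) (Num.sqrt s') <=
  spoly (gamma_transform r) (Num.sqrt ((s + s') / 2)) ^+ 2.
Proof.
move=> p0 q0 r0 pqr s0 s'0.
have ss0 : 0 <= (s + s') / 2 by rewrite divr_ge0// addr_ge0// ltW.
rewrite expr2 -lee_fin !EFinM -!integral_spoly_sqrt//; [|exact: ltW..].
have ge0 (k : 'I_m -> R) (c x : R) : (forall i, 0 <= k i) ->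
    0 <= spoly k (Num.sqrt (c * x)) * expR (- x).
  by move=> k0; rewrite mulr_ge0 ?expR_ge0// spoly_ge0// sqrtr_ge0.
have mid (x y : R) : `]0, +oo[%classic x -> `]0, +oo[%classic y ->
    `]0, +oo[%classic ((x + y) / 2).
  by rewrite /= !in_itv/= !andbT => x0 y0; rewrite divr_gt0// addr_gt0.
apply: prekopa_leindler_on => //; [exact: measurable_spoly_sqrt..|
  by move=> x _; exact: ge0|by move=> x _; exact: ge0|
  by move=> x _; exact: ge0|].
move=> x y; rewrite /= !in_itv/= !andbT => x0 y0.
rewrite mulrACA -expRD exprMn -[in leRHS]expRM_natr.
have -> : - ((x + y) / 2) * 2%:R = - x - y by field.
apply: ler_wpM2r; first exact: expR_ge0.
apply: le_trans (pqr _ _ _ _) _; rewrite ?sqrtr_gt0 ?mulr_gt0//.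
have mid0 : 0 <= (Num.sqrt (s * x) + Num.sqrt (s' * y)) / 2.
  by rewrite divr_ge0// addr_ge0// sqrtr_ge0.
apply: lerXn2r; rewrite ?nnegrE ?spoly_ge0// ?sqrtr_ge0//.
by apply: ler_spoly => //; apply: sqrtr_midpoint; exact: ltW.
Qed.

End exponential_average.

(** * Log-concavity of the rigid motion volumes *)

Lemma integral_exprn (R : realType) (c : R) (k : nat) : 0 < c ->
  (\int[lebesgue_measure]_(x in `]0%R, c]) (x ^+ k)%:E =
   (c ^+ k.+1 / k.+1%:R)%:E)%E.
Proof.
move=> c0; rewrite integral_itv_obnd_cbnd; last first.
  by apply/measurable_EFinP; exact: measurable_funX.
pose F : R -> R := k.+1%:R^-1 \*: (@id R ^+ k.+1).
have dF (x : R) : is_derive x 1 F (x ^+ k).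
  apply: is_derive_eq; rewrite -[LHS]/(_^-1 * (_ * x ^+ k * 1)).
  by rewrite mulr1 mulKf// pnatr_eq0.
have contF : continuous (F : R -> R).
  move=> x; apply/differentiable_continuous/derivable1_diffP; apply: ex_derive.
rewrite (@continuous_FTC2 _ (fun x => x ^+ k) F)//.
- by rewrite /F/= !fctE/= expr0n/= scaler0 sube0 [_ *: _]mulrC.
- by apply: continuous_subspaceT => x; exact: exprn_continuous.
- split=> [x _||]; first exact: ex_derive.
  + by apply: cvg_at_right_filter; exact: contF.
  + by apply: cvg_at_left_filter; exact: contF.
- by move=> x _; rewrite derive1E derive_val.
Qed.

Section rigid_motion_volume_log_concavity.
Context {R : realType} {n : nat}.
Implicit Types (K : set 'rV[R]_n) (a b s t : R).

(* [W(s,t)] up to the factor pi^{(n+1)/2}. *)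
Definition weighted_sum (V : {ffun 'I_n.+1 -> R}) s t : R :=
  \sum_i V i / omega i.+1 * (Num.sqrt s ^+ (n - i) * Num.sqrt t ^+ i.+1).

Section steiner_polynomial.
Context (K : set 'rV[R]_n) (V : {ffun 'I_n.+1 -> R}).
Hypotheses (cK : convex_body K) (KV : steiner K V) (V0 : forall i, 0 <= V i).

Let coef (i : 'I_n.+1) : R := kappa (n - i) * V i.

Let kappa_gt0 (j : nat) : 0 < kappa j :> R.
Proof. by rewrite divr_gt0 ?powR_gt0 ?pi_gt0 ?Gamma_gt0. Qed.

Let coef_ge0 i : 0 <= coef i.
Proof. by rewrite mulr_ge0// ltW. Qed.

Let Q a b : R := \sum_i coef i * (a ^+ i * b ^+ (n - i)).

Let Q_ge0 a b : 0 <= a -> 0 <= b -> 0 <= Q a b.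
Proof.
move=> a0 b0; apply: sumr_ge0 => i _; apply: mulr_ge0; first exact: coef_ge0.
by rewrite mulr_ge0 ?exprn_ge0.
Qed.

Let volume_scaled_sumE a b : 0 < a -> 0 <= b ->
  volume (scaled_sum K a b) = (Q a b)%:E.
Proof.
move=> a0 b0; rewrite volume_scaled_sum// KV ?divr_ge0 ?(ltW a0)// -EFinM.
congr EFin; rewrite mulr_sumr; apply: eq_bigr => i _.
rewrite /coef expr_div_n -{1}(subnKC (leq_ord i)) exprD.
by field; rewrite expf_neq0// gt_eqF.
Qed.

Let Q_midpoint a b a' b' : 0 < a -> 0 < a' -> 0 <= b -> 0 <= b' ->
  Q a b * Q a' b' <= Q ((a + a') / 2) ((b + b') / 2) ^+ 2.
Proof.
move=> a0 a'0 b0 b'0.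
have := volume_scaled_sum_brunn_minkowski cK a0 a'0 b0 b'0.
by rewrite !volume_scaled_sumE// ?divr_gt0 ?divr_ge0 ?addr_gt0 ?addr_ge0.
Qed.

Let codim (i : 'I_n.+1) : nat := n - i.
Let succ (i : 'I_n.+1) : nat := i.+1.

Let p (c : R) (i : 'I_n.+1) : R := coef i * (c ^+ i.+1 / i.+1%:R).

Let p_ge0 c i : 0 <= c -> 0 <= p c i.
Proof. move=> c0; apply: mulr_ge0; first exact: coef_ge0.
by rewrite mulr_ge0 ?exprn_ge0 ?invr_ge0. Qed.

Let integral_Q b c : 0 <= b -> 0 < c ->
  (\int[lebesgue_measure]_(a in `]0%R, c]) (Q a b)%:E =
   (spoly codim (p c) b)%:E)%E.
Proof.
move=> b0 c0.
transitivity (\int[lebesgue_measure]_(a in `]0%R, c]) (\sum_i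
    (coef i * b ^+ (n - i))%:E * (a ^+ i)%:E)%E)%E.
  apply: eq_integral => a _; rewrite -sumEFin; apply: eq_bigr => i _.
  by rewrite -EFinM; congr EFin; ring.
have c1 i : (0 <= (coef i * b ^+ (n - i))%:E)%E.
  by rewrite lee_fin mulr_ge0 ?coef_ge0 ?exprn_ge0.
have mX (k : nat) : measurable_fun `]0%R, c] (fun a : R => (a ^+ k)%:E).
  by apply/measurable_EFinP; exact: measurable_funX.
have X0 (k : nat) (a : R) : `]0%R, c]%classic a -> (0 <= (a ^+ k)%:E)%E.
  by rewrite /= in_itv/= => /andP[a0 _]; rewrite lee_fin exprn_ge0// ltW.
rewrite ge0_integral_sum//.
- rewrite /spoly -sumEFin; apply: eq_bigr => i _.
  rewrite ge0_integralZl//; [|exact: mX|exact: X0].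
  by rewrite integral_exprn// -EFinM mulrAC.
- by move=> i; apply: emeasurable_funM; [by []|exact: mX].
- by move=> i a Da; rewrite mule_ge0// X0.
Qed.

(** Here c enters through the domain of integration only: midpoints of (0, c] and (0, c'] lie in (0,
    (c + c')/2]. *)
Let p_midpoint c c' b b' : 0 < c -> 0 < c' -> 0 < b -> 0 < b' ->
  spoly codim (p c) b * spoly codim (p c') b' <=
  spoly codim (p ((c + c') / 2)) ((b + b') / 2) ^+ 2.
Proof.
move=> c0 c'0 b0 b'0.
have cc0 : 0 < (c + c') / 2 by rewrite divr_gt0// addr_gt0.
have bb0 : 0 < (b + b') / 2 by rewrite divr_gt0// addr_gt0.
rewrite expr2 -lee_fin !EFinM -!integral_Q//; [|exact: ltW..].
have mQ b1 (D : set R) : measurable_fun D (Q ^~ b1).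
  apply: measurable_funTS; apply: measurable_sum => i.
  by apply: measurable_funM => //; apply: measurable_funM => //; exact: measurable_funX.
have Q0 c1 b1 x : 0 < b1 -> `]0%R, c1]%classic x -> 0 <= Q x b1.
  by rewrite /= in_itv/= => b10 /andP[x0 _]; rewrite Q_ge0// ltW.
apply: prekopa_leindler_on => //.
- by move=> x Dx; exact: Q0 Dx.
- by move=> x Dx; exact: Q0 Dx.
- by move=> x Dx; exact: Q0 Dx.
- move=> x y /=; rewrite !in_itv/= => /andP[x0 xc] /andP[y0 yc].
  by rewrite divr_gt0 ?addr_gt0//= ler_pM2r// lerD.
- move=> x y /=; rewrite !in_itv/= => /andP[x0 xc] /andP[y0 yc].
  by apply: Q_midpoint => //; exact: ltW.
Qed.

Let q (s : R) (i : 'I_n.+1) : R :=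
  pi `^ ((n - i)%:R / 2) * V i * Num.sqrt s ^+ (n - i) / i.+1%:R.

Let q_ge0 s i : 0 <= q s i.
Proof. by rewrite !mulr_ge0 ?powR_ge0 ?exprn_ge0 ?sqrtr_ge0 ?invr_ge0. Qed.

(** Gamma(1 + (n-i)/2) cancels the denominator of kappa_{n-i}. The average, a polynomial in sqrt(s),
    is then regrouped as a polynomial in c, ready for the second average. *)
Let gamma_p s c :
  spoly codim (gamma_transform codim (p c)) (Num.sqrt s) = spoly succ (q s) c.
Proof.
apply: eq_bigr => i _; rewrite /gamma_transform /p /q /coef /kappa /succ /codim.
by field; rewrite nat1r pnatr_eq0 (gt_eqF (Gamma_gt0 _)).
Qed.

Let q_midpoint s s' c c' : 0 < s -> 0 < s' -> 0 < c -> 0 < c' ->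
  spoly succ (q s) c * spoly succ (q s') c' <=
  spoly succ (q ((s + s') / 2)) ((c + c') / 2) ^+ 2.
Proof.
move=> s0 s'0 c0 c'0; rewrite -!gamma_p; apply: gamma_transform_midpoint => //.
- by move=> i; rewrite p_ge0 ?ltW.
- by move=> i; rewrite p_ge0 ?ltW.
- by move=> i; rewrite p_ge0// divr_ge0// addr_ge0// ltW.
- by move=> x y x0 y0; exact: p_midpoint.
Qed.

(** Gamma(1 + (i+1)/2)/(i+1) equals pi^{(i+1)/2}/omega_{i+1}, and the two powers of pi multiply to
    the same constant for every i. *)
Let gamma_q s t :
  spoly succ (gamma_transform succ (q s)) (Num.sqrt t) =
  pi `^ (n.+1%:R / 2) * weighted_sum V s t.
Proof.
rewrite mulr_sumr; apply: eq_bigr => i _.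
have -> : n.+1%:R / 2 = (n - i)%:R / 2 + i.+1%:R / 2 :> R.
  by rewrite -mulrDl -natrD addnS subnK// leq_ord.
rewrite powRD; last by rewrite (gt_eqF (pi_gt0 R)) implybT.
rewrite /gamma_transform /q /omega /kappa /succ.
field; rewrite nat1r pnatr_eq0.
by rewrite (gt_eqF (Gamma_gt0 _)) (gt_eqF (powR_gt0 _ (pi_gt0 R))).
Qed.

Lemma steiner_log_concave s s' t t' : 0 < s -> 0 < s' -> 0 < t -> 0 < t' ->
  weighted_sum V s t * weighted_sum V s' t' <=
  weighted_sum V ((s + s') / 2) ((t + t') / 2) ^+ 2.
Proof.
move=> s0 s'0 t0 t'0.
have := @gamma_transform_midpoint R n.+1 succ (q s) (q s') (q ((s + s') / 2)) t t'
  (q_ge0 _) (q_ge0 _) (q_ge0 _) (fun x y => q_midpoint s0 s'0) t0 t'0.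
rewrite !gamma_q mulrACA exprMn -expr2 ler_pM2l//.
by rewrite exprn_gt0// powR_gt0// pi_gt0.
Qed.

End steiner_polynomial.
End rigid_motion_volume_log_concavity.

(** * Concentration *)

Lemma ge0_of_derive (R : realType) (f df : R -> R) :
  (forall x : R, is_derive x 1 f (df x)) -> f 0 = 0 ->
  (forall x, 0 <= x -> 0 <= df x) -> forall x, 0 <= x -> 0 <= f x.
Proof.
move=> fdf f0 df0 x; rewrite le_eqVlt => /predU1P[<-|x0]; first by rewrite f0.
have [|c] := @MVT R f df 0 x x0 (fun y _ => fdf y).
  by apply: derivable_within_continuous => y _; exact: ex_derive.
rewrite f0 subr0 subr0 => /[!in_itv]/= /andP[c0 _] ->.
by apply: mulr_ge0; [apply: df0|]; exact: ltW.
Qed.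

Lemma expRN_le_quadratic (R : realType) (w : R) :
  0 <= w -> expR (- w) <= 1 - w + w ^+ 2 / 2.
Proof.
move=> w0; rewrite -subr_ge0.
pose f : R -> R := cst 1 - id + 2^-1 \*: (id ^+ 2) - (expR \o -%R).
have -> : 1 - w + w ^+ 2 / 2 - expR (- w) = f w.
  rewrite /f !fctE/= /GRing.scale/=. by field.
apply: (@ge0_of_derive R f (fun x => expR (- x) - (1 + (- x)))); last exact: w0.
- by move=> x; apply: is_derive_eq; rewrite /GRing.scale/= expr1; field.
- rewrite /f !fctE/= /GRing.scale/= oppr0 expR0; ring.
- by move=> x _; rewrite subr_ge0 expR_ge1Dx.
Qed.

(** The difference of the two sides and its derivative vanish at 0, and its second derivative (1 +
    (w - 1) e^w)/3 is nonnegative since 1 - w <= e^{-w}. The factor 1/3 makes the cubic Taylor terms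
    cancel; it is the source of t/3 in the tail bound. *)
Lemma expR_le_bernstein (R : realType) (w : R) : 0 <= w ->
  (1 - w / 3) * (expR w - 1 - w) <= w ^+ 2 / 2.
Proof.
move=> w0; rewrite -subr_ge0.
pose f : R -> R := 2^-1 \*: (id ^+ 2) - (cst 1 - 3^-1 \*: id) * (expR - cst 1 - id).
pose g : R -> R := id + 3^-1 \*: (expR - cst 1 - id) -
  (cst 1 - 3^-1 \*: id) * (expR - cst 1).
rewrite (_ : _ - _ = f w); last first.
  by rewrite /f !fctE/= /GRing.scale/=; field.
apply: (@ge0_of_derive R f g) w0 => [x||].
- by apply: is_derive_eq; rewrite /g !fctE/= /GRing.scale/= expr1; field.
- rewrite /f !fctE/= /GRing.scale/= expR0; ring.
apply: (@ge0_of_derive R g (fun x => 3^-1 * (1 + (x - 1) * expR x))) => [x||].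
- by apply: is_derive_eq; rewrite !fctE/= /GRing.scale/=; field.
- by rewrite /g !fctE/= /GRing.scale/= expR0; ring.
move=> x x0; rewrite mulr_ge0//.
have := expR_ge1Dx (- x); rewrite -(@ler_pM2r _ (expR x)) ?expR_gt0//.
by rewrite -expRD addNr expR0; lra.
Qed.

(** A first-order expansion at 1 with uniform quadratic error. The size of [C] is irrelevant to its
    use: the error gets divided by an arbitrarily large 2^k. *)
Lemma expr1D_le_quadratic (R : realFieldType) (k : nat) : exists2 C : R, 0 <= C &
  forall y : R, -1 <= y <= 1 -> (1 + y) ^+ k <= 1 + k%:R * y + C * y ^+ 2.
Proof.
elim: k => [|k [C C0 IH]].
  by exists 0 => // y _; rewrite expr0 mul0r mul0r !addr0.
exists (k%:R + 2 * C); first by rewrite addr_ge0// mulr_ge0.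
move=> y /andP[y0 y1]; have := IH y; rewrite y0 y1 => /(_ isT) le.
rewrite exprSr; apply: (@le_trans _ _ ((1 + k%:R * y + C * y ^+ 2) * (1 + y))).
  by apply: ler_wpM2r => //; lra.
have : 0 <= C * y ^+ 2 * (1 - y) by rewrite mulr_ge0 ?subr_ge0// mulr_ge0 ?sqr_ge0.
by rewrite -natr1; lra.
Qed.

Section log_concave_generating_function.
Context {R : realType} {m : nat} (e : 'I_m -> nat) (p : 'I_m -> R).
Hypotheses (p0 : forall i, 0 <= p i) (p1 : \sum_i p i = 1).
Hypothesis F_midpoint : forall s s', 0 < s -> 0 < s' ->
  spoly e p (Num.sqrt s) * spoly e p (Num.sqrt s') <=
  spoly e p (Num.sqrt ((s + s') / 2)) ^+ 2.

Let F (s : R) := spoly e p (Num.sqrt s).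
Let delta := \sum_i p i * (e i)%:R.

Let F1 : F 1 = 1.
Proof.
by rewrite /F /spoly sqrtr1 -[RHS]p1; apply: eq_bigr => i _; rewrite expr1n mulr1.
Qed.

Let F_ge0 s : 0 <= F s.
Proof. by apply: spoly_ge0 => //; exact: sqrtr_ge0. Qed.

(** Midpoint log-concavity between u and 1 reads F(u) <= F((1 + u)/2)^2 because F(1) = 1; each
    iteration halves the distance to 1. *)
Let F_le_dyadic (s : R) (k : nat) : 0 < s ->
  F s <= F (1 + (s - 1) / 2 ^+ k) ^+ (2 ^ k).
Proof.
move=> s0; elim: k => [|k IH].
  by rewrite expr0 divr1 addrC subrK expr1.
apply: le_trans IH _; rewrite expnS exprM.
apply: lerXn2r; rewrite ?nnegrE ?exprn_ge0//.
have P0 : 0 < 2 ^+ k :> R by rewrite exprn_gt0.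
have P1 : 1 <= 2 ^+ k :> R by rewrite exprn_ege1// ler1n.
have u0 : 0 < 1 + (s - 1) / 2 ^+ k.
  rewrite -(pmulr_lgt0 _ P0) mulrDl divfK ?gt_eqF//; lra.
have := F_midpoint u0 ltr01; rewrite -/(F 1) F1 mulr1.
congr (_ <= F _ ^+ 2); rewrite exprS; field.
by rewrite gt_eqF.
Qed.

(** With h = (s - 1)/2^k, the dyadic bound F(1 + h)^(2^k) approaches exp((s - 1) delta/2), as
    delta/2 is the slope of F at 1. The quadratic error estimate makes this quantitative. *)
Lemma generating_function_le (s : R) : 0 < s ->
  F s <= expR ((s - 1) * delta / 2).
Proof.
move=> s0.
have [C C0 quad] : exists2 C : R, 0 <= C & forall i (y : R), -1 <= y <= 1 ->
    (1 + y) ^+ e i <= 1 + (e i)%:R * y + C * y ^+ 2.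
  have /boolp.choice[c cP] : forall i, exists C : R, 0 <= C /\
      forall y : R, -1 <= y <= 1 -> (1 + y) ^+ e i <= 1 + (e i)%:R * y + C * y ^+ 2.
    by move=> i; have [C C0 CP] := expr1D_le_quadratic R (e i); exists C.
  exists (\sum_i c i) => [|i y y1]; first by apply: sumr_ge0 => i _; have [] := cP i.
  have [_ /(_ y y1) le] := cP i; apply: le_trans le _; rewrite lerD2l.
  apply: ler_wpM2r; first exact: sqr_ge0.
  by rewrite (bigD1 i)//= lerDl; apply: sumr_ge0 => j _; have [] := cP j.
(* The first reduction is sqrt(1 + h) <= 1 + h/2, which turns half-integer powers into integer
   ones. *)
have F_le (h : R) : -1 <= h / 2 <= 1 -> F (1 + h) <= expR (h / 2 * delta + C * (h / 2) ^+ 2).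
  move=> h1; apply: le_trans (expR_ge1Dx _).
  apply: (@le_trans _ _ (\sum_i p i * (1 + h / 2) ^+ e i)).
    rewrite -[leRHS]/(spoly e p (1 + h / 2)) /F.
    apply: (ler_spoly _ p0 (sqrtr_ge0 _)).
    rewrite -[leRHS]ger0_norm; last lra.
    by rewrite -sqrtr_sqr; apply: ler_wsqrtr; have := sqr_ge0 h; nra.
  rewrite -[X in _ <= X + _]p1 /delta mulr_sumr.
  have -> : C * (h / 2) ^+ 2 = \sum_i p i * (C * (h / 2) ^+ 2).
    by rewrite -mulr_suml p1 mul1r.
  rewrite addrA -!big_split/=; apply: ler_sum => i _.
  have -> : p i + h / 2 * (p i * (e i)%:R) + p i * (C * (h / 2) ^+ 2) =
      p i * (1 + (e i)%:R * (h / 2) + C * (h / 2) ^+ 2) by ring.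
  by apply: ler_wpM2l => //; exact: quad.
have [//|lt_F] := leP (F s) (expR ((s - 1) * delta / 2)).
have Fs0 : 0 < F s by apply: lt_trans lt_F; exact: expR_gt0.
(* Half of the supposed gap in the exponent, so an error of at most [eps] is contradictory. *)
pose eps := (ln (F s) - (s - 1) * delta / 2) / 2.
have eps0 : 0 < eps.
  by rewrite divr_gt0// subr_gt0 -ltr_expR lnK.
pose D := C * (s - 1) ^+ 2 / 4.
have D0 : 0 <= D by rewrite divr_ge0// mulr_ge0// sqr_ge0.
(* |s - 1| < 2^k puts h in the range of the quadratic estimate; D/eps < 2^k bounds the accumulated
   error 2^k C (h/2)^2 = D/2^k by [eps]. *)
have [k kP] : exists k : nat, `|s - 1| + D / eps < 2 ^+ k.
  exists (Num.bound (`|s - 1| + D / eps)).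
  apply: (@lt_le_trans _ _ (Num.bound (`|s - 1| + D / eps))%:R).
    by apply: archi_boundP; rewrite addr_ge0// divr_ge0// ltW.
  by rewrite -natrX ler_nat ltnW// ltn_expl.
have P0 : 0 < 2 ^+ k :> R by rewrite exprn_gt0.
have sk : `|s - 1| < 2 ^+ k.
  by apply: le_lt_trans kP; rewrite lerDl divr_ge0// ltW.
have Dk : D / 2 ^+ k <= eps.
  rewrite ler_pdivrMr// mulrC -ler_pdivrMr//; apply: le_trans (ltW kP).
  by rewrite lerDr normr_ge0.
pose h := (s - 1) / 2 ^+ k.
have h1 : -1 <= h / 2 <= 1.
  have : `|h| < 1 by rewrite normrM normfV (gtr0_norm P0) ltr_pdivrMr// mul1r.
  rewrite ltr_norml; move: (h) => z /andP[zN z1].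
  by apply/andP; split; lra.
have : F s <= expR ((s - 1) * delta / 2 + eps).
  apply: le_trans (F_le_dyadic k s0) _.
  apply: (@le_trans _ _ (expR (h / 2 * delta + C * (h / 2) ^+ 2) ^+ (2 ^ k))).
    by apply: lerXn2r; [exact: F_ge0|exact: expR_ge0|exact: F_le].
  rewrite -expRM_natr ler_expR natrX.
  have -> : (h / 2 * delta + C * (h / 2) ^+ 2) * 2 ^+ k =
      (s - 1) * delta / 2 + D / 2 ^+ k.
    by rewrite /h /D; field; rewrite gt_eqF.
  by rewrite lerD2l.
rewrite -[X in X <= _]lnK// ler_expR => le_ln.
by move: eps0 le_ln; rewrite /eps; move: (ln _) (_ * _ / 2) => u v; lra.
Qed.

Lemma concentration_of_log_concave (t : R) : 0 <= t ->
  \sum_(i | t <= `|(e i)%:R - delta|) p i <=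
  2 * expR ((- (t ^+ 2) / 4) / (delta + t / 3)).
Proof.
(* At t = 0 the bound is 2, whatever the denominator; for t > 0 the denominator is positive even if
   delta = 0. *)
rewrite le_eqVlt => /predU1P[<-|t0].
  rewrite expr0n oppr0 mul0r mul0r expR0 mulr1.
  apply: (@le_trans _ _ 1); last by rewrite ler1n.
  by rewrite -[leRHS]p1 [leRHS](bigID (fun i => 0 <= `|(e i)%:R - delta|))/= lerDl sumr_ge0.
have delta0 : 0 <= delta by apply: sumr_ge0 => i _; rewrite mulr_ge0.
have [D D0 DE] : exists2 D, 0 < D & delta + t / 3 = D.
  by exists (delta + t / 3) => //; rewrite ltr_wpDl// divr_gt0.
have deltaE : delta = D - t / 3 by rewrite -DE addrK.
rewrite DE.
(* This choice gives 1 - w/3 = delta/D, so Bernstein's estimate becomes delta (e^w - 1 - w) <= w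
   t/2. The Chernoff exponent (delta (e^w - 1 - w) - w t)/2 is then at most -w t/4 = -t^2/(4 D). *)
pose w := t / D.
have w0 : 0 < w by rewrite divr_gt0.
have sqrt_exp (x : R) : Num.sqrt (expR x) = expR (x / 2).
  rewrite -[RHS]ger0_norm ?expR_ge0// -sqrtr_sqr -expRM_natr; congr (Num.sqrt (expR _)).
  by field.
have chernoff (x : R) : \sum_i p i * expR (x / 2 * (e i)%:R) <=
    expR ((expR x - 1) * delta / 2).
  apply: le_trans (generating_function_le (expR_gt0 x)).
  by rewrite /F sqrt_exp; apply: ler_sum => i _; rewrite expRM_natr.
have upper : \sum_(i | t <= (e i)%:R - delta) p i <= expR ((- (t ^+ 2) / 4) / D).
  apply: (@le_trans _ _ (\sum_i expR (- (w / 2 * (delta + t))) *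
      (p i * expR (w / 2 * (e i)%:R)))).
    rewrite [leRHS](bigID (fun i => t <= (e i)%:R - delta))/=.
    apply: ler_wpDr.
      by apply: sumr_ge0 => i _; rewrite !mulr_ge0// expR_ge0.
    apply: ler_sum => i ti; rewrite mulrCA -expRD -[leLHS]mulr1.
    apply: ler_wpM2l => //; rewrite -[leLHS]expR0 ler_expR.
    have -> : - (w / 2 * (delta + t)) + w / 2 * (e i)%:R =
      w / 2 * ((e i)%:R - delta - t) by ring.
    by rewrite mulr_ge0 ?divr_ge0 ?subr_ge0// ltW.
  rewrite -mulr_sumr; apply: le_trans (ler_wpM2l (expR_ge0 _) (chernoff w)) _.
  rewrite -expRD ler_expR.
  have := expR_le_bernstein (ltW w0).
  have -> : 1 - w / 3 = delta / D by rewrite deltaE /w; field; rewrite gt_eqF.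
  rewrite -(ler_pM2r D0) => le.
  have le' : delta * (expR w - 1 - w) <= w * t / 2.
    move: le; congr (_ <= _); rewrite /w; field; rewrite gt_eqF//.
  have -> : - t ^+ 2 / 4 / D = - (w * t) / 4.
    by rewrite /w; field; rewrite gt_eqF.
  by move: le'; lra.
(* The same w with s = e^{-w}: the exponent (delta (e^{-w} - 1 + w) - w t)/2 is at most -w t/4
   because delta w^2 <= D w^2 = w t. *)
have lower : \sum_(i | (e i)%:R - delta <= - t) p i <= expR ((- (t ^+ 2) / 4) / D).
  apply: (@le_trans _ _ (\sum_i expR (w / 2 * (delta - t)) *
      (p i * expR (- w / 2 * (e i)%:R)))).
    rewrite [leRHS](bigID (fun i => (e i)%:R - delta <= - t))/=.
    apply: ler_wpDr.
      by apply: sumr_ge0 => i _; rewrite !mulr_ge0// expR_ge0.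
    apply: ler_sum => i ti; rewrite mulrCA -expRD -[leLHS]mulr1.
    apply: ler_wpM2l => //; rewrite -[leLHS]expR0 ler_expR.
    have -> : w / 2 * (delta - t) + - w / 2 * (e i)%:R =
      w / 2 * (- t - ((e i)%:R - delta)) by ring.
    by rewrite mulr_ge0 ?divr_ge0 ?subr_ge0// ltW.
  rewrite -mulr_sumr; apply: le_trans (ler_wpM2l (expR_ge0 _) (chernoff _)) _.
  rewrite -expRD ler_expR.
  have : delta * expR (- w) <= delta * (1 - w + w ^+ 2 / 2).
    by apply: ler_wpM2l => //; apply: expRN_le_quadratic; exact: ltW.
  have : delta * w ^+ 2 <= w * t.
    have -> : w * t = D * w ^+ 2 by rewrite /w; field; rewrite gt_eqF.
    by apply: ler_wpM2r; [exact: sqr_ge0|rewrite -DE lerDl divr_ge0// ltW].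
  have -> : - t ^+ 2 / 4 / D = - (w * t) / 4.
    by rewrite /w; field; rewrite gt_eqF.
  by move: (expR (- w)) => x; lra.
apply: (@le_trans _ _ (\sum_(i | t <= (e i)%:R - delta) p i +
                      \sum_(i | (e i)%:R - delta <= - t) p i)); last first.
  by rewrite mulr_natl mulr2n lerD.
rewrite [X in X + _]big_mkcond [X in _ + X]big_mkcond -big_split big_mkcond/=.
apply: ler_sum => i _; rewrite ler_normr lerNr.
by case: ifPn => [/orP[]->|_]; rewrite ?lerDl ?lerDr ?addr_ge0//; case: ifP.
Qed.

End log_concave_generating_function.

(** * The finite law of the random variable *)

Section law.
Context {R : realType} {n : nat} {d : measure_display} {T : measurableType d}.
Context {P : probability T R} (I : {RV P >-> R}) (p : 'I_n.+1 -> R).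
Hypothesis IE : forall w, exists k : 'I_n.+1, I w = k%:R.
Hypothesis Ip : forall i : 'I_n.+1, P [set w | I w = (n - i)%:R] = (p i)%:E.

Lemma law_ge0 i : 0 <= p i.
Proof. by rewrite -lee_fin -Ip. Qed.

Lemma integral_law (phi : R -> R) : (forall x, 0 <= phi x) ->
  (\int[P]_w (phi (I w))%:E = (\sum_i p i * phi (n - i)%:R)%:E)%E.
Proof.
move=> phi0.
have mI i : measurable [set w | I w = (n - i)%:R].
  exact: (measurable_funPTI I (measurable_set1 (n - i)%:R)).
transitivity (\int[P]_w \sum_(i < n.+1)
    ((phi (n - i)%:R)%:E * (\1_[set w | I w = (n - i)%:R] w)%:E))%E.
  apply: eq_integral => w _; have [k Iw] := IE w.
  (* The value k belongs to the index n - k, which is [rev_ord k]. *)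
  rewrite (bigD1 (rev_ord k))//= indicE mem_set/=; last first.
    by rewrite subSS subKn ?leq_ord.
  rewrite mule1 big1 ?adde0; first by rewrite Iw subSS subKn ?leq_ord.
  move=> i ik; rewrite indicE memNset ?mule0//= Iw => /eqP.
  rewrite eqr_nat => /eqP kE; move/eqP: ik; apply; apply/val_inj => /=.
  by rewrite subSS kE subKn ?leq_ord.
rewrite ge0_integral_sum//.
- rewrite -sumEFin; apply: eq_bigr => i _.
  rewrite ge0_integralZl//.
  + rewrite integral_indic// setIT mulrC EFinM.
    by congr (_ * _)%E; exact: Ip.
  + by apply/measurable_EFinP; exact: measurable_indic.
  + by rewrite lee_fin.
- move=> i; apply: emeasurable_funM => //.
  by apply/measurable_EFinP; exact: measurable_indic.
- by move=> i w _; rewrite mule_ge0 ?lee_fin.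
Qed.

Lemma sum_law : \sum_i p i = 1.
Proof.
have := @integral_law (fun=> 1) (fun=> ler01).
rewrite integral_cst// mul1e => PT; apply: EFin_inj.
rewrite -(probability_setT P); under eq_bigr do rewrite -[p _]mulr1.
exact: (esym PT).
Qed.

Lemma expectation_law : central_volume I = \sum_i p i * (n - i)%:R.
Proof.
rewrite /central_volume expectation_def.
have -> : (\int[P]_w (I w)%:E = \int[P]_w (`|I w|)%:E)%E.
  by apply: eq_integral => w _; have [k ->] := IE w; rewrite normr_nat.
rewrite (@integral_law (fun x => `|x|))//=.
by apply: eq_bigr => i _; rewrite normr_nat.
Qed.

Lemma probability_law (A : pred R) : measurable [set w | A (I w)] ->
  (P [set w | A (I w)] = (\sum_(i < n.+1 | A (n - i)%:R) p i)%:E)%E.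
Proof.
move=> mA; rewrite -(setIT [set w | A (I w)]) -integral_indic//.
transitivity (\int[P]_w ((A (I w))%:R : R)%:E)%E.
  apply: eq_integral => w _; rewrite indicE.
  suff -> : (w \in [set w | A (I w)]) = A (I w) by [].
  by apply/idP/idP; rewrite inE.
rewrite (@integral_law (fun x => (A x)%:R))// [in RHS]big_mkcond/=.
by congr EFin; apply: eq_bigr => i _; case: ifP; rewrite ?mulr1 ?mulr0.
Qed.

End law.

Lemma omega_gt0 (R : realType) (j : nat) : 0 < omega j.+1 :> R.
Proof.
by rewrite /omega /kappa mulr_gt0// divr_gt0 ?powR_gt0 ?pi_gt0 ?Gamma_gt0.
Qed.

(** * Intrinsic volumes recovered from the law *)

Section rigid_motion_volume_law.
Context {R : realType} {n : nat} (K : set 'rV[R]_n).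
Hypothesis cK : convex_body K.
Let V := intrinsic_volume K.
Let W := total_rigid_motion_volume K.
Let p (i : 'I_n.+1) : R := rigid_motion_volume K i / W.
Hypotheses (p0 : forall i, 0 <= p i) (p1 : \sum_i p i = 1).

Let W_neq0 : W != 0.
Proof.
apply/eqP => W0; move: p1; rewrite big1 => [/eqP|i _].
  by rewrite eq_sym oner_eq0.
by rewrite /p W0 invr0 mulr0.
Qed.

(* Without a solution of Steiner's formula the junk value 0 of
   [intrinsic_volume] could not give a probability law. *)
Lemma steiner_intrinsic_volume : steiner K V.
Proof.
rewrite /V /intrinsic_volume; case: xgetP => [U _ //|noV].
have V0 i : rigid_motion_volume K i = 0.
  by rewrite /rigid_motion_volume /intrinsic_volume xgetPN// ffunE mulr0.
by move: W_neq0; rewrite /W /total_rigid_motion_volume big1 ?eqxx.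
Qed.

(** The law fixes only the sign of V_i/W. If W were negative, the nonnegative volume of K + B would
    force every V_j to vanish. *)
Lemma intrinsic_volume_ge0 i : 0 <= V i.
Proof.
have rmvE j : rigid_motion_volume K j = p j * W by rewrite /p divfK.
have omega_pos j : 0 < omega n.+1 / omega j.+1 :> R.
  by rewrite divr_gt0 ?omega_gt0.
have [W0|W0] := leP 0 W.
  rewrite -(pmulr_rge0 _ (omega_pos i)) -/(rigid_motion_volume K i) rmvE.
  exact: mulr_ge0.
(* If [W < 0] then all [V j <= 0], but a positive combination is a volume. *)
have V_le0 j : V j <= 0.
  rewrite -(pmulr_rle0 _ (omega_pos j)) -/(rigid_motion_volume K j) rmvE.
  by rewrite mulr_ge0_le0// ltW.
have kappa_gt0 j : 0 < kappa j :> R.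
  by rewrite /kappa divr_gt0 ?powR_gt0 ?pi_gt0 ?Gamma_gt0.
have : 0 <= \sum_(j < n.+1) 1 ^+ (n - j) * kappa (n - j) * V j.
  rewrite -lee_fin -(steiner_intrinsic_volume ler01).
  exact: (measure_ge0 (@lebesgue_tuple R n)).
have le0 (j : 'I_n.+1) : 1 ^+ (n - j) * kappa (n - j) * V j <= 0.
  by rewrite expr1n mul1r mulr_ge0_le0// ltW.
have := @sumr_le0 _ _ (index_enum 'I_n.+1) xpredT _ (fun j _ => le0 j).
move=> sum_le0 sum_ge0.
have : \sum_(j < n.+1) - (1 ^+ (n - j) * kappa (n - j) * V j) = 0.
  by apply/eqP; rewrite sumrN oppr_eq0 eq_le sum_le0.
move/eqP; rewrite psumr_eq0 => [/allP sum0|j _]; last by rewrite oppr_ge0.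
have := sum0 i (mem_index_enum i).
by rewrite oppr_eq0 expr1n mul1r mulf_eq0 gt_eqF//= => /eqP ->.
Qed.

Lemma spoly_codim s : spoly (fun i : 'I_n.+1 => (n - i)%N) p (Num.sqrt s) =
  omega n.+1 / W * weighted_sum V s 1.
Proof.
rewrite mulr_sumr; apply: eq_bigr => i _.
rewrite sqrtr1 expr1n /p /rigid_motion_volume -/V; field.
by rewrite W_neq0 gt_eqF ?omega_gt0.
Qed.

Lemma spoly_succ t : spoly (fun i : 'I_n.+1 => i.+1) p (Num.sqrt t) =
  omega n.+1 / W * weighted_sum V 1 t.
Proof.
rewrite mulr_sumr; apply: eq_bigr => i _.
rewrite sqrtr1 expr1n /p /rigid_motion_volume -/V; field.
by rewrite W_neq0 gt_eqF ?omega_gt0.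
Qed.

Lemma concentration_codim delta t :
  delta = \sum_i p i * (n - i)%:R -> 0 <= t ->
  \sum_(i < n.+1 | t <= `|(n - i)%:R - delta|) p i <=
  2 * expR ((- (t ^+ 2) / 4) / (delta + t / 3)).
Proof.
move=> -> t0.
apply: (@concentration_of_log_concave R n.+1 (fun i => (n - i)%N) p) => //.
move=> s s' s0 s'0; rewrite !spoly_codim mulrACA exprMn -expr2.
apply: ler_wpM2l; first exact: sqr_ge0.
have := steiner_log_concave cK steiner_intrinsic_volume intrinsic_volume_ge0
  s0 s'0 ltr01 ltr01.
by rewrite -(natrD _ 1 1) divff.
Qed.

(** The variable with value i + 1 at index i is n + 1 - I, and its mean is n + 1 - delta for the
    mean delta of I. *)
Lemma concentration_succ delta t :
  delta = \sum_i p i * i.+1%:R -> 0 <= t ->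
  \sum_(i < n.+1 | t <= `|i.+1%:R - delta|) p i <=
  2 * expR ((- (t ^+ 2) / 4) / (delta + t / 3)).
Proof.
move=> -> t0.
apply: (@concentration_of_log_concave R n.+1 (fun i => i.+1) p) => //.
move=> s s' s0 s'0; rewrite !spoly_succ mulrACA exprMn -expr2.
apply: ler_wpM2l; first exact: sqr_ge0.
have := steiner_log_concave cK steiner_intrinsic_volume intrinsic_volume_ge0
  ltr01 ltr01 s0 s'0.
by rewrite -(natrD _ 1 1) divff.
Qed.

End rigid_motion_volume_law.

Theorem theorem2 (R : realType) (n : nat) (hn : (1 <= n)%N)
    (K : set 'rV[R]_n) (hK : convex_body K) (hK0 : K !=set0)
    (d : measure_display) (T : measurableType d) (P : probability T R)
    (I : {RV P >-> R}) (hI : rigid_motion_volume_rv K I) :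
  let delta := central_volume I in
  let sigma2 := Num.min delta (n.+1%:R - delta) in
  forall t : R, 0 <= t ->
    (P [set w | (t <= `|I w - delta|)%R] <=
      (2 * expR ((- (t ^+ 2) / 4) / (sigma2 + t / 3)))%:E)%E.
Proof.
case: hI => IE Ip delta sigma2 t t0.
pose p (i : 'I_n.+1) : R :=
  rigid_motion_volume K i / total_rigid_motion_volume K.
have p0 : forall i, 0 <= p i := law_ge0 Ip.
have p1 : \sum_i p i = 1 := sum_law IE Ip.
have deltaE : delta = \sum_i p i * (n - i)%:R := expectation_law IE Ip.
have codeltaE : n.+1%:R - delta = \sum_i p i * i.+1%:R.
  have -> : n.+1%:R = \sum_i p i * n.+1%:R :> R by rewrite -mulr_suml p1 mul1r.
  rewrite deltaE -sumrB; apply: eq_bigr => i _.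
  by rewrite natrB ?leq_ord// -!natr1; ring.
have mA : measurable [set w | t <= `|I w - delta|].
  apply: (measurable_funPTI I (Y := [set x : R | t <= `|x - delta|])).
  have : measurable_fun [set: R] (fun x : R => t <= `|x - delta|).
    apply: measurable_fun_ler => //; apply: measurableT_comp.
      exact: normr_measurable.
    exact: measurable_funB.
  by move=> /(_ measurableT [set true]); rewrite setTI; exact.
have -> : P [set w | (t <= `|I w - delta|)%R] =
    (\sum_(i < n.+1 | t <= `|(n - i)%:R - delta|) p i)%:E.
  exact: (probability_law IE Ip (A := fun x => t <= `|x - delta|) mA).
rewrite lee_fin /sigma2; case: (leP delta (n.+1%:R - delta)) => _.
  exact: (concentration_codim hK p0 p1 deltaE t0).
(* I and n + 1 - I deviate from their means by opposite amounts, so their tail events coincide. *)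
apply: le_trans (concentration_succ hK p0 p1 codeltaE t0).
rewrite le_eqVlt; apply/orP; left; apply/eqP; apply: eq_bigl => i.
congr (t <= _); rewrite -normrN; congr (`|_|).
by rewrite natrB ?leq_ord// -!natr1; ring.
Qed.
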